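(* Let $T>0$, let $u_0$ be an admissible initial value, and let $M_0=\int_\Omega u_0(\mathbf{x})\,\mathrm{d}\mathbf{x}$. Suppose that $\kappa\ge \max_{|\xi|\le 1}(|f'(\xi)|+|g'(\xi)|)=4$ and $\|u_0\|\le 1$ with $|M_0|\neq|\Omega|$. Assume that the exact solution $u$ of the mass-conserving Allen-Cahn problem belongs to $C^2([0,T];C(\overline\Omega))$, let $\gamma_u>0$ be a constant such that $\int_\Omega g(u(\mathbf{x},t))\,\mathrm{d}\mathbf{x}\ge\gamma_u$ for all $t\in[0,T]$, and let $\{u^n\in C(\overline\Omega)\}_{n\ge0}$ be the approximate solution generated by the ETDRK2 scheme with time step $\tau$. Assume furthermore that there exists a constant $\gamma_d>0$ such that $\int_\Omega g(u^n(\mathbf{x}))\,\mathrm{d}\mathbf{x}\ge\gamma_d$ for any $n$ with $n\tau\le T$, and define $\gamma=\min(\gamma_u,\gamma_d)$. Then, for any $\tau>0$, with $t_n=n\tau$, $$\|u(t_n)-u^n\|\le C\,e^{(C^*_\gamma-1)\kappa t_n}\,\tau^2,\qquad \forall\, t_n\le T,$$ where the constant $C>0$ is independent of $\tau$, and $$C^*_\gamma=\frac32+\frac{C_\gamma}{4},\qquad C_\gamma=\frac{4|\Omega|}{\gamma}+\frac{2|\Omega|^2}{\gamma^2}.$$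
   Context: Let $\Omega\subset\mathbb{R}^d$ ($d=2,3$) be open, connected and bounded with Lipschitz boundary, $\varepsilon>0$, and let $\|\cdot\|$ be the supremum norm on $C(\overline\Omega)$. Boundary conditions: either homogeneous Neumann ($\partial u/\partial\mathbf{n}=0$ on $\partial\Omega$), or periodic, in which case $\Omega=\prod_{i=1}^d(a_i,b_i)$ and all functions, including $u_0$, are periodic. An admissible initial value is $u_0\in C(\overline\Omega)$ (periodic in the periodic case). Put $f(s)=s-s^3$, $g(s)=1-s^2$, and for $\xi\in C(\overline\Omega)$ with $\int_\Omega g(\xi)\,\mathrm{d}\mathbf{x}\ne0$, $$\lambda_\xi=\frac{\int_\Omega f(\xi(\mathbf{x}))\,\mathrm{d}\mathbf{x}}{\int_\Omega g(\xi(\mathbf{x}))\,\mathrm{d}\mathbf{x}},\qquad \mathcal{N}[\xi]=\kappa\xi+f(\xi)-\lambda_\xi\, g(\xi).$$ The mass-conserving Allen-Cahn problem is $$\partial_t u=\varepsilon^2\Delta u+f(u)-\lambda_{u(\cdot,t)}\,g(u)\ \text{ in }\Omega,\ t>0,\qquad u(\cdot,0)=u_0,$$ with the chosen boundary condition; equivalently $\partial_t u=\mathcal{L}_\kappa u+\mathcal{N}[u]$ with $\mathcal{L}_\kappa=\varepsilon^2\Delta-\kappa\mathcal{I}$. It conserves mass, $\int_\Omega u(\mathbf{x},t)\,\mathrm{d}\mathbf{x}=M_0$, and it is known (Alfaro–Alifrangis) that $\|u_0\|\le1$ implies $\|u(t)\|\le 1$ for all $t\ge0$. When $|M_0|\ne|\Omega|$,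 a constant $\gamma_u$ as in the claim always exists, by continuity of $u$. The constants $\gamma_u,\gamma_d$ are regarded as fixed (not varying with $\tau$). Here $\Delta$ is the Laplacian with the chosen boundary condition; $\{e^{t\Delta}\}_{t\ge0}$ is the contraction semigroup it generates with respect to the supremum norm (on $C(\overline\Omega)$, or its subspace of periodic functions in the periodic case), and $e^{t\mathcal{L}_\kappa}=e^{-\kappa t}e^{t\varepsilon^2\Delta}$. ETDRK2 scheme with step $\tau>0$: $u^0=u_0$, and for $n\ge 0$, $u^{n+1}=w^n(\tau)$, where $w^n$ solves $\partial_s w^n=\mathcal{L}_\kappa w^n+(1-\frac{s}{\tau})\mathcal{N}[u^n]+\frac{s}{\tau}\mathcal{N}[\tilde u^{n+1}]$ in $\Omega$ for $s\in(0,\tau]$, $w^n(\cdot,0)=u^n$, with the chosen boundary condition, and $\tilde u^{n+1}$ is obtained from $u^n$ by one step of the first-order ETD1 scheme. Equivalently, $$\tilde u^{n+1}=e^{\tau\mathcal{L}_\kappa}u^n+\int_0^\tau e^{(\tau-s)\mathcal{L}_\kappa}\mathcal{N}[u^n]\,\mathrm{d}s,$$ $$u^{n+1}=e^{\tau\mathcal{L}_\kappa}u^n+\int_0^\tau e^{(\tau-s)\mathcal{L}_\kappa}\Big[\Big(1-\frac{s}{\tau}\Big)\mathcal{N}[u^n]+\frac{s}{\tau}\mathcal{N}[\tilde u^{n+1}]\Big]\,\mathrm{d}s.$$ *)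

(* Defs.v *)
From HB Require Import structures.
From mathcomp Require Import all_boot all_order all_algebra.
From mathcomp Require Import all_classical all_reals all_analysis.
From mathcomp Require Import ring lra.

Set Implicit Arguments.
Unset Strict Implicit.
Unset Printing Implicit Defensive.

Import Order.TTheory GRing.Theory Num.Theory.
Import numFieldNormedType.Exports.

Local Open Scope classical_set_scope.
Local Open Scope ring_scope.

(** Lebesgue measure on [R^n] is built on the measurable type [n.-tuple R] (product of the Borel
    sigma-algebras), as the image of [lebesgue_measure \x leb n] under
    [(x, t) |-> x :: t], starting from the unit mass on the one-point space
    [R^0]. *)

Section tuple_cons.
Context {R : realType} (n : nat).
Local Notation mR := (measurableTypeR R).

Definition tcons (p : mR * n.-tuple mR) : n.+1.-tuple mR := [tuple of p.1 :: p.2].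

Lemma measurable_tcons : measurable_fun [set: mR * n.-tuple mR] tcons.
Proof. exact: measurable_cons. Qed.

Definition leb_cons (mu : {sigma_finite_measure set (n.-tuple mR) -> \bar R}) :
    set (n.+1.-tuple mR) -> \bar R :=
  pushforward (@lebesgue_measure R \x mu)%E tcons.

Section leb_cons_measure.
Variable mu : {sigma_finite_measure set (n.-tuple mR) -> \bar R}.

HB.instance Definition _ := Measure.copy (leb_cons mu)
  (measure_function_pushforward__canonical__measure_function_Measure
     (@lebesgue_measure R \x mu)%E measurable_tcons).

Lemma leb_cons_sigma_finite : sigma_finite setT (leb_cons mu).
Proof.
have /sigma_finiteP[F [FT ndF Foo]] := sigma_finiteT (@lebesgue_measure R).
have /sigma_finiteP[G [GT ndG Goo]] := sigma_finiteT mu.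
pose unc (t : n.+1.-tuple mR) : mR * n.-tuple mR := (thead t, [tuple of behead t]).
have tconsK : cancel tcons unc.
  by case=> x t; rewrite /unc/= theadE; congr pair; exact/val_inj.
have munc : measurable_fun [set: n.+1.-tuple mR] unc.
  apply/measurable_fun_pairP; split; first exact: measurable_tnth.
  exact: measurable_behead.
exists (fun k => unc @^-1` (F k `*` G k)).
  rewrite -preimage_bigcup (_ : \bigcup_k _ = setT) ?preimage_setT//.
  rewrite -subTset => -[x t] _.
  have : [set: mR] x by []. rewrite FT => -[i _ Fix].
  have : [set: n.-tuple mR] t by []. rewrite GT => -[j _ Gjt].
  exists (maxn i j) => //; split.
    by move: Fix; exact/subsetPset/ndF/leq_maxl.
  by move: Gjt; exact/subsetPset/ndG/leq_maxr.
move=> k; have [mF Fk] := Foo k; have [mG Gk] := Goo k.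
have mFG : measurable (F k `*` G k) by exact: measurableX.
split; first by rewrite -[X in measurable X]setTI; exact: munc.
rewrite /leb_cons /pushforward -comp_preimage.
rewrite (_ : unc \o tcons = id) ?preimage_id; last exact/funext.
by rewrite product_measure1E// lte_mul_pinfty// ge0_fin_numE.
Qed.

HB.instance Definition _ := Measure_isSigmaFinite.Build _ _ _ (leb_cons mu)
  leb_cons_sigma_finite.
End leb_cons_measure.
End tuple_cons.

Fixpoint leb {R : realType} (n : nat) :
    {sigma_finite_measure set (n.-tuple (measurableTypeR R)) -> \bar R} :=
  if n is n'.+1 then leb_cons (leb n') else \d_([tuple]).

Definition open_box {R : realType} (n : nat) (a b : 'I_n -> R) :
    set (n.-tuple (measurableTypeR R)) :=
  [set t | forall i, a i < (tnth t i : R) < b i].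

Lemma measurable_open_box {R : realType} (n : nat) (a b : 'I_n -> R) :
  measurable (open_box a b).
Proof.
rewrite (_ : open_box a b = \bigcap_(i in [set: 'I_n])
    ((fun t => tnth t i) @^-1` `]a i, b i[%classic)); last first.
  apply/seteqP; split => t /= h i; first by move=> _; rewrite /= in_itv; exact: h.
  by have := h i I; rewrite /= in_itv.
apply: fin_bigcap_measurable => [|i _]; first exact: finite_finset.
by rewrite -[X in measurable X]setTI; exact: measurable_tnth.
Qed.

Lemma leb_open_box {R : realType} (n : nat) (a b : 'I_n -> R) :
  (forall i, a i < b i) ->
  leb n (open_box a b) = (\prod_i (b i - a i))%:E.
Proof.
elim: n a b => [|n IH] a b ab.
  by rewrite /= diracE mem_set ?big_ord0// => -[].
rewrite /= /leb_cons /pushforward.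
have -> : @tcons R n @^-1` open_box a b = `]a ord0, b ord0[%classic `*`
    open_box (fun i => a (lift ord0 i)) (fun i => b (lift ord0 i)).
  apply/seteqP; split => -[x t] /= h.
    split=> [|i]; first by have := h ord0; rewrite /= in_itv.
    by have := h (lift ord0 i); rewrite tnthS.
  case: h => /=; rewrite in_itv /= => hx ht i.
  by case: (unliftP ord0 i) => [j ->|->] //; rewrite tnthS; exact: ht.
rewrite product_measure1E//; last exact: measurable_open_box.
rewrite [leb n _]IH => [|i]; last exact: ab.
have lebI : lebesgue_measure (`]a ord0, b ord0[%classic : set R) =
    (b ord0 - a ord0)%:E.
  by rewrite lebesgue_measure_itv /= lte_fin ab.
by rewrite big_ord_recl EFinM -lebI.
Qed.

Section domain.
Context {R : realType} {d : nat}.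
Local Notation E := 'rV[R]_d.
Implicit Types (Om : set E) (phi psi eta : E -> R).

Definition vec_of_tuple (t : d.-tuple (measurableTypeR R)) : E :=
  \row_i (tnth t i : R).

Definition integral_over Om phi : R :=
  (\int[leb d]_(t in vec_of_tuple @^-1` Om) phi (vec_of_tuple t))%R.

Definition volume Om : R := fine (leb d (vec_of_tuple @^-1` Om)).

Definition L2 Om phi : Prop :=
  measurable_fun (vec_of_tuple @^-1` Om) (phi \o vec_of_tuple) /\
  (leb d).-integrable (vec_of_tuple @^-1` Om)
    (fun t => ((phi (vec_of_tuple t)) ^+ 2)%:E).

Definition dotv (x y : E) : R := \sum_i x 0 i * y 0 i.

(** Near each boundary point, [Om] is the strict epigraph of a Lipschitz
    function over the hyperplane orthogonal to a unit vector [e].  The graph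
    function [h] is only evaluated on that hyperplane, where its being defined
    and Lipschitz on the whole space is no restriction. *)
Definition lipschitz_boundary Om : Prop :=
  forall x0, (closure Om `\` Om°) x0 ->
    exists (e : E) (h : E -> R), [/\ dotv e e = 1, lipschitz h &
      \forall x \near x0, Om x <-> h (x - dotv x e *: e) < dotv x e].

Inductive boundary_condition :=
| Neumann
| Periodic of E & E. (* lower and upper corners of the box *)

Definition compatible (bc : boundary_condition) Om : Prop :=
  match bc with
  | Neumann => True
  | Periodic a b => (forall i, a 0 i < b 0 i) /\
      Om = [set x | forall i, a 0 i < x 0 i < b 0 i]
  end.

(** Elements of [C(closure Om)] (of its periodic subspace in the periodic case)
    are represented by functions on [R^d] whose values outside [closure Om] are
    irrelevant. *)
Definition in_C (bc : boundary_condition) Om phi : Prop :=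
  {within closure Om, continuous phi} /\
  match bc with
  | Neumann => True
  | Periodic a b => forall (i : 'I_d) x, closure Om x -> x 0 i = a 0 i ->
      phi (x + (b 0 i - a 0 i) *: delta_mx 0 i) = phi x
  end.

Definition supnorm Om phi : R := sup [set `|phi x| | x in closure Om].

Definition partial (i : 'I_d) phi : E -> R := 'D_(delta_mx 0 i) phi.

Definition C1 phi : Prop := forall i : 'I_d,
  (forall x, derivable phi x (delta_mx 0 i)) /\ continuous (partial i phi).

Definition compactly_supported_in Om phi : Prop :=
  exists K, [/\ compact K, K `<=` Om & forall x, ~ K x -> phi x = 0].

(** [G] is the weak gradient of [phi] in [Om], and [phi] is in [H^1(Om)]. *)
Definition H1_gradient Om phi (G : 'I_d -> E -> R) : Prop :=
  L2 Om phi /\ forall i, L2 Om (G i) /\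
    forall eta, C1 eta -> compactly_supported_in Om eta ->
      integral_over Om (fun x => phi x * partial i eta x) =
      - integral_over Om (fun x => G i x * eta x).

(** Restrictions to [Om] of these functions are dense in [H^1(Om)] (Neumann,
    [Om] bounded Lipschitz), resp. in its periodic subspace. *)
Definition test_function (bc : boundary_condition) eta : Prop :=
  C1 eta /\
  match bc with
  | Neumann => True
  | Periodic a b => forall (i : 'I_d) x,
      eta (x + (b 0 i - a 0 i) *: delta_mx 0 i) = eta x
  end.

(** [is_laplacian bc Om phi psi]: [phi] is in the domain of the Laplacian and
    its image is [psi].  On a Lipschitz domain the normal derivative has no
    pointwise meaning in general, and the Neumann condition is the natural
    boundary condition of the variational formulation
    [\int grad phi . grad eta = - \int psi eta], in which [eta] is not required
    to vanish on the boundary. *)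
Definition is_laplacian (bc : boundary_condition) Om phi psi : Prop :=
  [/\ in_C bc Om phi, in_C bc Om psi &
    exists2 G, H1_gradient Om phi G &
      forall eta, test_function bc eta ->
        \sum_i integral_over Om (fun x => G i x * partial i eta x) =
        - integral_over Om (fun x => psi x * eta x)].

(** Strongly continuous contraction semigroup for the supremum norm.
    Only [S t] with [0 <= t] is meaningful. *)
Record contraction_semigroup (bc : boundary_condition) Om
    (S : R -> (E -> R) -> (E -> R)) : Prop := ContractionSemigroup {
  semigroup_in_C : forall t phi, 0 <= t -> in_C bc Om phi ->
    in_C bc Om (S t phi);
  semigroup_linear : forall t c phi psi, 0 <= t ->
    in_C bc Om phi -> in_C bc Om psi ->
    {in closure Om, S t (fun x => c * phi x + psi x) =1
                    (fun x => c * S t phi x + S t psi x)};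
  semigroup0 : forall phi, in_C bc Om phi -> {in closure Om, S 0 phi =1 phi};
  semigroupD : forall s t phi, 0 <= s -> 0 <= t -> in_C bc Om phi ->
    {in closure Om, S (s + t) phi =1 S s (S t phi)};
  semigroup_contraction : forall t phi, 0 <= t -> in_C bc Om phi ->
    supnorm Om (S t phi) <= supnorm Om phi;
  semigroup_continuous : forall phi, in_C bc Om phi ->
    supnorm Om (fun x => S t phi x - phi x) @[t --> 0^'+] --> (0 : R)
}.

Definition generated_by_laplacian (bc : boundary_condition) Om
    (S : R -> (E -> R) -> (E -> R)) : Prop :=
  forall phi psi, in_C bc Om phi -> in_C bc Om psi ->
    (is_laplacian bc Om phi psi <->
     supnorm Om (fun x => h^-1 * (S h phi x - phi x) - psi x) @[h --> 0^'+]
       --> (0 : R)).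

(** Derivative at [t] in the supremum norm, one-sided if [t] is 0 or [T]. *)
Definition is_time_derivative Om (T : R) (u : R -> E -> R) (t : R)
    (v : E -> R) : Prop :=
  supnorm Om (fun x => h^-1 * (u (t + h) x - u t x) - v x)
    @[h --> within [set h | 0 <= t + h <= T] (0 : R)^'] --> (0 : R).

Definition C2_in_time (bc : boundary_condition) Om (T : R)
    (u : R -> E -> R) : Prop :=
  exists u1 u2 : R -> E -> R,
    forall t, 0 <= t <= T ->
      [/\ in_C bc Om (u t), in_C bc Om (u1 t) & in_C bc Om (u2 t)] /\
      [/\ is_time_derivative Om T u t (u1 t),
          is_time_derivative Om T u1 t (u2 t) &
          supnorm Om (fun x => u2 s x - u2 t x)
            @[s --> within `[0, T] (nbhs t)] --> (0 : R)].
End domain.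

Definition fAC {R : realType} (s : R) : R := s - s ^+ 3.
Definition gAC {R : realType} (s : R) : R := 1 - s ^+ 2.

Definition stab_const {R : realType} : R :=
  sup [set `|derive1 fAC xi| + `|derive1 gAC xi| | xi in `[-1, 1 : R]].

Lemma derive1_fAC {R : realType} (s : R) : derive1 fAC s = 1 - 3 * s ^+ 2.
Proof.
rewrite derive1E /fAC derive_val.
by rewrite /GRing.scale /=; ring.
Qed.

Lemma derive1_gAC {R : realType} (s : R) : derive1 gAC s = - (2 * s).
Proof.
rewrite derive1E /gAC derive_val.
by rewrite /GRing.scale /=; ring.
Qed.

Lemma stab_constE {R : realType} : @stab_const R = 4.
Proof.
have H0 : [set `|derive1 fAC xi| + `|derive1 gAC xi| | xi in `[-1, 1 : R]] 4.
  exists 1; first by rewrite /= in_itv /=; apply/andP; split; lra.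
  rewrite derive1_fAC derive1_gAC ler0_norm; last by lra.
  by rewrite ler0_norm; lra.
have H1 : ubound [set `|derive1 fAC xi| + `|derive1 gAC xi| | xi in `[-1, 1 : R]] 4.
  move=> _ [x xI <-]; move: xI; rewrite /= in_itv /= => /andP[x1 x2].
  rewrite derive1_fAC derive1_gAC.
  by case: (ger0P (1 - 3 * x ^+ 2)) => ?; case: (ger0P (- (2 * x))) => ?; nra.
apply/eqP; rewrite eq_le; apply/andP; split.
  by apply: ge_sup => //; exists 4.
by apply: ub_le_sup => //; exists 4.
Qed.

Section allen_cahn.
Context {R : realType} {d : nat}.
Local Notation E := 'rV[R]_d.
Variables (bc : @boundary_condition R d) (Om : set E) (eps kappa : R).

(** [0] by convention when the denominator vanishes. *)
Definition lambda (xi : E -> R) : R :=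
  integral_over Om (fAC \o xi) / integral_over Om (gAC \o xi).

Definition Nop (xi : E -> R) : E -> R :=
  fun x => kappa * xi x + fAC (xi x) - lambda xi * gAC (xi x).

Definition exact_solution (T : R) (u0 : E -> R) (u : R -> E -> R) : Prop :=
  {in closure Om, u 0 =1 u0} /\
  forall t, 0 < t <= T -> exists v psi : E -> R,
    [/\ is_time_derivative Om T u t v, is_laplacian bc Om (u t) psi &
      {in closure Om, v =1 fun x =>
        eps ^+ 2 * psi x + fAC (u t x) - lambda (u t) * gAC (u t x)}].

Variable S : R -> (E -> R) -> (E -> R).

Definition expL (t : R) (phi : E -> R) : E -> R :=
  fun x => expR (- (kappa * t)) * S (eps ^+ 2 * t) phi x.

Definition etd1 (tau : R) (phi : E -> R) : E -> R :=
  fun x => expL tau phi x +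
    \int[@lebesgue_measure R]_(s in `[0, tau]) expL (tau - s) (Nop phi) x.

Definition etdrk2 (tau : R) (phi : E -> R) : E -> R :=
  fun x => expL tau phi x +
    \int[@lebesgue_measure R]_(s in `[0, tau])
      expL (tau - s)
        (fun y => (1 - s / tau) * Nop phi y +
                  (s / tau) * Nop (etd1 tau phi) y) x.

Definition etdrk2_iter (tau : R) (u0 : E -> R) (n : nat) : E -> R :=
  iter n (etdrk2 tau) u0.
End allen_cahn.

(* Main.v *)
Require Import Defs.
From HB Require Import structures.
From mathcomp Require Import all_boot all_order all_algebra.
From mathcomp Require Import all_classical all_reals all_analysis.
From mathcomp Require Import ring lra.

(** The solution and the scheme are compared through the variation of constants
    formula, in the supremum norm on the closed domain.  Below [e^(tL)] is
    [expL t], of norm at most [exp(- kappa t)], and [N] is [Nop].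

    As the Laplacian generates the semigroup, [s |-> e^((h - s)L) u(t + s)] has
    derivative [e^((h - s)L) N(u(t + s))] ([is_derive_expL_path]).  A step of an
    exponential integrator replaces [N(u(t + s))] by some [Q s]; it therefore
    misses [u(t + h)] by at most [exp(- kappa h)] times the initial error plus
    the integral of [exp(- kappa (h - s)) |N(u(t + s)) - Q s|]
    ([solution_step_le]).  Three facts bound this integrand.

    - Maximum principle.  For [4 <= kappa], [|xi| <= 1] implies
      [|N(xi)| <= kappa] ([Nop_bound]).  Both stages of the scheme thus stay in
      the unit ball ([exponential_step_bound]), and so does the solution, by an
      iteration on a bound of its excess over 1 ([solution_le1]).

    - Stability.  If the integral of [g(xi)] is at least [g0], then
      [|N(xi) - N(eta)|] is at most [kappa + 4 / 3 + 4 |Om| / g0] times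
      [|xi - eta|] in the unit ball ([Nop_lipschitz]).  For [xi = u(t)] this
      constant is at most [Cstar kappa].

    - Consistency.  Over a step [tau], [N(u(t))] is linear in [t] up to
      [O(tau ^+ 2)] ([Nop_solution_C11_path]), because [u] is twice
      differentiable in time and [N] is built from [u] by products, integrals
      and one quotient.

    With [c = (Cstar - 1) kappa], an error [e] before a step becomes at most
    [(1 + c tau) e + O(tau ^+ 2)] after the first stage ([etd1_error]) and at
    most [exp(c tau) e + O(tau ^+ 3)] after the second ([etdrk2_error]).
    Summing over the at most [T / tau] steps gives the theorem. *)

Set Implicit Arguments.
Unset Strict Implicit.
Unset Printing Implicit Defensive.

Import Order.TTheory GRing.Theory Num.Theory.
Import numFieldNormedType.Exports.

Local Open Scope classical_set_scope.
Local Open Scope ring_scope.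

(** * Continuous functions on the closed domain *)

Section continuous_functions.
Context {R : realType} {d : nat}.
Local Notation E := 'rV[R]_d.
Variables (bc : @boundary_condition R d) (Om : set E).
Implicit Types phi psi : E -> R.

Lemma in_C_cst c : in_C bc Om (fun=> c).
Proof. by split; [exact: cst_continuous | case: bc]. Qed.

Lemma in_CD phi psi : in_C bc Om phi -> in_C bc Om psi ->
  in_C bc Om (fun x => phi x + psi x).
Proof.
move=> [cphi pphi] [cpsi ppsi]; split.
  by move=> x; apply: cvgD; [exact: cphi | exact: cpsi].
by case: bc pphi ppsi => // a b pphi ppsi i x Kx xa; rewrite pphi// ppsi.
Qed.

Lemma in_CM phi psi : in_C bc Om phi -> in_C bc Om psi ->
  in_C bc Om (fun x => phi x * psi x).
Proof.
move=> [cphi pphi] [cpsi ppsi]; split.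
  by move=> x; apply: cvgM; [exact: cphi | exact: cpsi].
by case: bc pphi ppsi => // a b pphi ppsi i x Kx xa; rewrite pphi// ppsi.
Qed.

Lemma in_CZ c phi : in_C bc Om phi -> in_C bc Om (fun x => c * phi x).
Proof. by move=> Cphi; apply: in_CM => //; exact: in_C_cst. Qed.

Lemma in_CB phi psi : in_C bc Om phi -> in_C bc Om psi ->
  in_C bc Om (fun x => phi x - psi x).
Proof.
move=> Cphi Cpsi; rewrite (_ : (fun _ => _) = fun x => phi x + -1 * psi x).
  by apply: in_CD => //; exact: in_CZ.
by apply/funext => x; rewrite mulN1r.
Qed.

Lemma in_C_gAC phi : in_C bc Om phi -> in_C bc Om (gAC \o phi).
Proof.
move=> Cphi; rewrite (_ : gAC \o phi = fun x => 1 - phi x * phi x).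
  by apply: in_CB; [exact: in_C_cst | exact: in_CM].
by apply/funext => x; rewrite /= /gAC expr2.
Qed.

Lemma in_C_fAC phi : in_C bc Om phi -> in_C bc Om (fAC \o phi).
Proof.
move=> Cphi; rewrite (_ : fAC \o phi = fun x => phi x * (gAC \o phi) x).
  by apply: in_CM => //; exact: in_C_gAC.
by apply/funext => x; rewrite /= /fAC /gAC; ring.
Qed.

Lemma in_C_Nop kappa phi : in_C bc Om phi -> in_C bc Om (Nop Om kappa phi).
Proof.
move=> Cphi; apply: in_CB; last by apply: in_CZ; exact: in_C_gAC.
by apply: in_CD; [exact: in_CZ | exact: in_C_fAC].
Qed.

Hypothesis bO : bounded_set Om.

Lemma compact_closure : compact (closure Om).
Proof.
apply: bounded_closed_compact; last exact: closed_closure.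
have [M [Mreal OmM]] := bO.
exists (Num.max M 0); split; first by rewrite max_real// real0.
move=> N MN; have N0 : 0 < N by rewrite (le_lt_trans _ MN)// le_max lexx orbT.
have sub : Om `<=` [set x | `|x| <= N].
  by move=> x; apply: OmM; rewrite (le_lt_trans _ MN)// le_max lexx.
have clN : closed [set x : E | `|x| <= N].
  rewrite [X in closed X](_ : _ = @Num.norm _ E @^-1` [set y | y <= N]) //.
  by apply: closed_comp; [move=> x _; exact: norm_continuous | exact: closed_le].
move=> x /(closure_subset sub).
by rewrite -(iffLR (closure_id _) clN).
Qed.

Lemma in_C_bounded phi : in_C bc Om phi ->
  exists M, forall x, closure Om x -> `|phi x| <= M.
Proof.
move=> [cphi _].
have /compact_bounded [M [_ OmM]] := continuous_compact cphi compact_closure.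
exists (M + 1) => x Kx; apply: (OmM (M + 1)); first by rewrite ltrDl.
by exists x.
Qed.

Lemma supnorm_ubound phi x : in_C bc Om phi -> closure Om x ->
  `|phi x| <= supnorm Om phi.
Proof.
move=> /in_C_bounded[M phiM] Kx; apply: ub_le_sup; last by exists x.
by exists M => _ [y Ky <-]; exact: phiM.
Qed.

Lemma supnorm_le phi M : 0 <= M -> (forall x, closure Om x -> `|phi x| <= M) ->
  supnorm Om phi <= M.
Proof.
move=> M0 phiM; rewrite /supnorm.
have [[y Ay]|nA] := pselect (exists y, [set `|phi x| | x in closure Om] y).
  by apply: ge_sup; [exists y | move=> _ [x Kx <-]; exact: phiM].
rewrite (_ : [set `|phi x| | x in closure Om] = set0) ?sup0//.
by apply/seteqP; split=> // y Ay; exfalso; apply: nA; exists y.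
Qed.

End continuous_functions.

(** * Integration over the domain *)

Section domain_integral.
Context {R : realType} {d : nat}.
Local Notation E := 'rV[R]_d.

(** Sets of the form [open_box p q] with rational corners form a countable base
    of the topology, so an open set is a countable union of measurable boxes. *)
Lemma measurable_open (U : set E) : open U -> measurable (@vec_of_tuple R d @^-1` U).
Proof.
move=> oU.
pose Q := ({ffun 'I_d -> rat} * {ffun 'I_d -> rat})%type.
pose box (p : Q) : set (d.-tuple (measurableTypeR R)) :=
  open_box (fun i => ratr (p.1 i)) (fun i => ratr (p.2 i)).
pose F (p : Q) := [set t | box p t /\ box p `<=` vec_of_tuple @^-1` U].
rewrite (_ : _ @^-1` _ = \bigcup_p F p); last first.
  apply/seteqP; split => [t Ut|t [p _ [pt]]]; last by apply.
  have [e /= e0 eU] := (@nbhs_ballP _ _ _ _).1 (open_nbhs_nbhs (conj oU Ut)).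
  have lo i : {q : rat | ratr q \in `](tnth t i : R) - e, tnth t i[}.
    by apply: cid; apply: rat_in_itvoo; rewrite ltrBlDr ltrDl.
  have hi i : {q : rat | ratr q \in `](tnth t i : R), tnth t i + e[}.
    by apply: cid; apply: rat_in_itvoo; rewrite ltrDl.
  exists ([ffun i => sval (lo i)], [ffun i => sval (hi i)]) => //; split.
    move=> i /=; rewrite !ffunE.
    case: (lo i) => q /=; case: (hi i) => q' /=; rewrite !in_itv/=.
    by move=> /andP[-> _] /andP[_ ->].
  move=> t' bt'; apply: eU; split => // i j.
  have := bt' j; rewrite /= !ffunE /vec_of_tuple !mxE /ball/=.
  case: (lo j) => q /=; case: (hi j) => q' /=; rewrite !in_itv/=.
  move=> /andP[h1 h2] /andP[h3 h4] /andP[h5 h6].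
  by rewrite ltr_norml; apply/andP; split; lra.
apply: countable_bigcupT_measurable => [|p]; first exact: countableP.
have [sub|nsub] := pselect (box p `<=` vec_of_tuple @^-1` U).
  rewrite (_ : F p = box p); first exact: measurable_open_box.
  by apply/seteqP; split => [t []|t] //.
rewrite (_ : F p = set0) //.
by apply/seteqP; split => // t [].
Qed.

Variables (bc : @boundary_condition R d) (Om : set E).
Hypotheses (oO : open Om) (bO : bounded_set Om).
Implicit Types phi psi : E -> R.
Let D := @vec_of_tuple R d @^-1` Om.

Lemma leb_bounded_fin : (leb d D < +oo)%E.
Proof.
have [M [Mreal OmM]] := bO.
pose N := Num.max (M + 1) 1.
have N0 : 0 < N by rewrite lt_max ltr01 orbT.
have sub : D `<=` open_box (fun=> - (N + 1)) (fun=> N + 1).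
  move=> t Dt i; rewrite -ltr_norml.
  apply: le_lt_trans (_ : N < N + 1); last by rewrite ltrDl.
  have : `|vec_of_tuple t| <= N by apply: (OmM N) => //; rewrite lt_max ltrDl ltr01.
  apply: le_trans; rewrite [X in _ <= X]mx_normrE.
  apply: le_trans (le_bigmax _ _ (ord0, i)) => /=.
  by rewrite mxE.
apply: le_lt_trans (le_measure _ _ _ sub) _; rewrite ?inE.
- exact: measurable_open.
- exact: measurable_open_box.
- by rewrite [X in (X < _)%E]leb_open_box ?ltry// => i; lra.
Qed.

Lemma volume_ge0 : 0 <= volume Om.
Proof. exact: fine_ge0. Qed.

Lemma in_C_integrable phi : in_C bc Om phi ->
  (leb d).-integrable D (EFin \o (phi \o vec_of_tuple)).
Proof.
move=> Cphi; have mD := measurable_open oO.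
have [M phiM] := in_C_bounded bO Cphi.
apply: measurable_bounded_integrable => //; first exact: leb_bounded_fin.
  apply: (measurability _ (measurable_realfun.RGenOpens.measurableE R)).
  move=> _ [_ [a [b ->] <-]].
  rewrite (_ : _ `&` _ =
    vec_of_tuple @^-1` (Om `&` phi @^-1` `]a, b[%classic)) //.
  apply: measurable_open.
  have cphi := continuous_subspaceW (@subset_closure _ Om) Cphi.1.
  rewrite openE => x [Ox phix]; apply: filterI; first exact: open_nbhs_nbhs.
  move: cphi; rewrite continuous_open_subspace// => /(_ x).
  rewrite inE => /(_ Ox); apply.
  by apply: open_nbhs_nbhs; split => //; exact: interval_open.
exists M; split; first exact: num_real.
move=> N MN t Dt /=; apply: le_trans (ltW MN).
exact/phiM/subset_closure.
Qed.

Lemma integral_overD phi psi : in_C bc Om phi -> in_C bc Om psi ->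
  integral_over Om (fun x => phi x + psi x) =
  integral_over Om phi + integral_over Om psi.
Proof.
by move=> Cphi Cpsi; rewrite /integral_over RintegralD//;
  [exact: measurable_open | exact: in_C_integrable | exact: in_C_integrable].
Qed.

Lemma integral_overZ c phi : in_C bc Om phi ->
  integral_over Om (fun x => c * phi x) = c * integral_over Om phi.
Proof.
by move=> Cphi; rewrite /integral_over RintegralZl//;
  [exact: measurable_open | exact: in_C_integrable].
Qed.

Lemma integral_overB phi psi : in_C bc Om phi -> in_C bc Om psi ->
  integral_over Om (fun x => phi x - psi x) =
  integral_over Om phi - integral_over Om psi.
Proof.
by move=> Cphi Cpsi; rewrite /integral_over RintegralB//;
  [exact: measurable_open | exact: in_C_integrable | exact: in_C_integrable].
Qed.

Lemma integral_over_cst c : integral_over Om (fun=> c) = c * volume Om.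
Proof. by rewrite /integral_over Rintegral_cst//; exact: measurable_open. Qed.

Lemma le_integral_over phi psi : in_C bc Om phi -> in_C bc Om psi ->
  (forall x, closure Om x -> phi x <= psi x) ->
  integral_over Om phi <= integral_over Om psi.
Proof.
move=> Cphi Cpsi le; apply: le_Rintegral.
- exact: measurable_open.
- exact: in_C_integrable.
- exact: in_C_integrable.
- by move=> t Dt; exact/le/subset_closure.
Qed.

Lemma ler_norm_integral_over phi psi : in_C bc Om phi -> in_C bc Om psi ->
  (forall x, closure Om x -> `|phi x| <= psi x) ->
  `|integral_over Om phi| <= integral_over Om psi.
Proof.
move=> Cphi Cpsi le; rewrite ler_norml; apply/andP; split.
  rewrite -mulN1r -integral_overZ//; apply: le_integral_over => //.
    exact: in_CZ.
  by move=> x /le; rewrite ler_norml mulN1r => /andP[].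
by apply: le_integral_over => // x /le; rewrite ler_norml => /andP[].
Qed.

Lemma integral_over_bound phi M : in_C bc Om phi ->
  (forall x, closure Om x -> `|phi x| <= M) ->
  `|integral_over Om phi| <= M * volume Om.
Proof.
move=> Cphi phiM; rewrite -integral_over_cst.
by apply: ler_norm_integral_over => //; exact: in_C_cst.
Qed.

End domain_integral.

(** * Paths of continuous functions and their integrals in time *)

Section paths.
Context {R : realType} {d : nat}.
Local Notation E := 'rV[R]_d.
Variables (bc : @boundary_condition R d) (Om : set E).
Implicit Types (Y : R -> E -> R) (x : E).

Definition continuous_path (h : R) Y : Prop :=
  forall s, 0 <= s <= h -> forall e, 0 < e -> exists2 del, 0 < del &
    forall s', 0 <= s' <= h -> `|s' - s| < del ->
    forall x, closure Om x -> `|Y s' x - Y s x| <= e.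

Lemma continuous_path_within h Y x : continuous_path h Y -> closure Om x ->
  {within `[0, h], continuous (fun s => Y s x)}.
Proof.
move=> cY Kx; apply/subspace_continuousP => s; rewrite /= in_itv/= => sh.
apply/cvgrPdist_le => e e0; have [del del0 Ydel] := cY _ sh _ e0.
rewrite near_withinE; apply: filterS (nbhsx_ballx s _ del0) => s' ss' s'h.
by rewrite distrC; apply: Ydel => //; rewrite distrC.
Qed.

Lemma path_integrable h Y x : continuous_path h Y -> closure Om x ->
  (@lebesgue_measure R).-integrable `[0, h] (EFin \o (fun s => Y s x)).
Proof.
move=> cY Kx; by apply: continuous_compact_integrable;
  [exact: segment_compact | exact: continuous_path_within].
Qed.

(** Compactness of [[0, h]] makes the family [Y s] equicontinuous, whence the
    continuity of its integral. *)
Lemma in_C_path_integral h Y : 0 < h ->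
  (forall s, 0 <= s <= h -> in_C bc Om (Y s)) -> continuous_path h Y ->
  in_C bc Om (fun x => \int[@lebesgue_measure R]_(s in `[0, h]) Y s x).
Proof.
move=> h0 CY cY.
have mI : measurable (`[0, h]%classic : set (measurableTypeR R)).
  exact: measurable_itv.
have mu_I : fine (@lebesgue_measure R `[0, h]) = h.
  by rewrite lebesgue_measure_itv/= lte_fin h0 oppr0 addr0.
split; last first.
  case: bc CY => // a b CY i x Kx xa; apply: eq_Rintegral => s.
  rewrite inE/= in_itv/= => sh; exact: (CY _ sh).2.
apply/subspace_continuousP => x Kx; apply/cvgrPdist_le => e e0.
pose e' := e / h / 3; have e'0 : 0 < e' by rewrite !divr_gt0.
have near_x : \forall y \near x, `[0, h]%classic `<=`
    [set s | 0 <= s <= h -> closure Om y -> `|Y s x - Y s y| <= 3 * e'].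
  have cover := iffLR (compact_near_coveringP _) (@segment_compact R 0 h).
  apply: (cover E (nbhs x)
    (fun y s => 0 <= s <= h -> closure Om y ->
      `|Y s x - Y s y| <= 3 * e')) => s.
  rewrite /= in_itv/= => sh.
  have [del del0 Ydel] := cY _ sh _ e'0.
  have /subspace_continuousP /(_ _ Kx) /cvgrPdist_le /(_ _ e'0) := (CY _ sh).1.
  rewrite near_withinE => nx.
  exists ([set s' | `|s - s'| < del], [set y | closure Om y -> `|Y s x - Y s y| <= e']).
    by split => //=; exact: (nbhsx_ballx s).
  move=> [s' y] /= [s'del yx] s'h Ky.
  have := Ydel _ s'h; rewrite distrC => /(_ s'del) Ys.
  have := yx Ky; have := Ys _ Kx; have := Ys _ Ky.
  rewrite !ler_norml => /andP[? ?] /andP[? ?] /andP[? ?].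
  by apply/andP; split; lra.
rewrite near_withinE.
apply: filterS near_x => y subY Ky.
have iY := path_integrable cY; rewrite -RintegralB//; [|exact: iY..].
have iYB : (@lebesgue_measure R).-integrable `[0, h]
    (EFin \o (fun s => Y s x - Y s y)).
  exact: (integrableB mI (iY _ Kx) (iY _ Ky)).
apply: le_trans (le_normr_Rintegral mI iYB) _.
have -> : e = \int[@lebesgue_measure R]_(s in `[0, h]) (3 * e').
  by rewrite Rintegral_cst// mu_I /e'; field; rewrite gt_eqF.
apply: le_Rintegral => //.
- exact: integrable_norm.
- apply: continuous_compact_integrable; first exact: segment_compact.
  by apply: continuous_subspaceT; exact: cst_continuous.
- by move=> s sI; apply: subY => //; move: sI; rewrite /= in_itv.
Qed.

End paths.

(** The majorant of [F' - H] is given through a primitive [B], so that no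
    integral ever has to be evaluated in the estimates. *)
Lemma ler_norm_FTC {R : realType} (h : R) (F G H B b : R -> R) : 0 < h ->
  (forall s : R, 0 < s < h -> is_derive s 1 F (G s)) ->
  {within `[0, h], continuous F} -> {within `[0, h], continuous G} ->
  {within `[0, h], continuous H} ->
  (forall s : R, is_derive s 1 B (b s)) -> continuous b ->
  (forall s, 0 <= s <= h -> `|G s - H s| <= b s) ->
  `|F h - F 0 - \int[@lebesgue_measure R]_(s in `[0, h]) H s| <= B h - B 0.
Proof.
move=> h0 dF cF cG cH dB cb GH.
have mI : measurable (`[0, h]%classic : set (measurableTypeR R)).
  exact: measurable_itv.
have iC (f : R -> R) : {within `[0, h], continuous f} ->
    (@lebesgue_measure R).-integrable `[0, h] (EFin \o f).
  by move=> cf; apply: continuous_compact_integrable => //; exact: segment_compact.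
have ftc (f g : R -> R) : {within `[0, h], continuous f} ->
    {within `[0, h], continuous g} ->
    (forall s : R, 0 < s < h -> is_derive s 1 f (g s)) ->
    \int[@lebesgue_measure R]_(s in `[0, h]) g s = f h - f 0.
  move=> cf cg df; rewrite /Rintegral (continuous_FTC2 (F := f))//.
    have [_ f0 fh] := iffLR (continuous_within_itvP f h0) cf.
    split => // s; rewrite in_itv/= => sh.
    by case: (df _ sh).
  move=> s; rewrite in_itv/= => sh; rewrite derive1E.
  by case: (df _ sh).
have cB : {within `[0, h], continuous B}.
  apply: continuous_subspaceT => s; apply/differentiable_continuous.
  by apply/derivable1_diffP; case: (dB s).
have {}cb : {within `[0, h], continuous b} by exact: continuous_subspaceT.
rewrite -(ftc _ _ cF cG dF) -(ftc _ _ cB cb) -?RintegralB//; [|exact: iC..].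
have iGH : (@lebesgue_measure R).-integrable `[0, h]
    (EFin \o (fun s => G s - H s)).
  exact: (integrableB mI (iC _ cG) (iC _ cH)).
apply: le_trans (le_normr_Rintegral mI iGH) _.
apply: le_Rintegral => [//|||s].
- exact: integrable_norm.
- exact: iC.
- by rewrite /= in_itv/=; exact: GH.
Qed.

(** * The contraction semigroup *)

Section semigroup.
Context {R : realType} {d : nat}.
Local Notation E := 'rV[R]_d.
Variables (bc : @boundary_condition R d) (Om : set E).
Variable S : R -> (E -> R) -> (E -> R).
Hypotheses (bO : bounded_set Om) (csg : contraction_semigroup bc Om S).
Implicit Types (phi psi : E -> R) (x : E).

Lemma semigroup_lin2 t a b phi psi x : 0 <= t ->
  in_C bc Om phi -> in_C bc Om psi -> closure Om x ->
  S t (fun y => a * phi y + b * psi y) x = a * S t phi x + b * S t psi x.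
Proof.
move=> t0 Cphi Cpsi Kx; have xK : x \in closure Om by rewrite inE.
rewrite (semigroup_linear csg a t0 Cphi (in_CZ b Cpsi) xK); congr (_ + _).
have C0 := in_C_cst bc Om (0 : R).
have S0 : S t (fun=> 0) x = 0.
  have := semigroup_linear csg 1 t0 C0 C0 xK; rewrite mul1r addr0 mul1r.
  by move/eqP; rewrite -subr_eq subrr => /eqP <-.
have := semigroup_linear csg b t0 Cpsi C0 xK.
rewrite S0 addr0 => <-; congr (S t _ x).
by apply/funext => y; rewrite addr0.
Qed.

Lemma semigroup_bound t phi M : 0 <= t -> 0 <= M -> in_C bc Om phi ->
  (forall x, closure Om x -> `|phi x| <= M) ->
  forall x, closure Om x -> `|S t phi x| <= M.
Proof.
move=> t0 M0 Cphi phiM x Kx.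
have CS := semigroup_in_C csg t0 Cphi.
apply: le_trans (supnorm_ubound bO CS Kx) _.
apply: le_trans (semigroup_contraction csg t0 Cphi) _.
exact: supnorm_le.
Qed.

(** The semigroup is only linear up to values outside the closed domain; this
    is the form in which linearity and contraction are used together. *)
Lemma semigroup_comb3 t a b c phi psi chi M : 0 <= t -> 0 <= M ->
  in_C bc Om phi -> in_C bc Om psi -> in_C bc Om chi ->
  (forall x, closure Om x -> `|a * phi x + b * psi x + c * chi x| <= M) ->
  forall x, closure Om x -> `|a * S t phi x + b * S t psi x + c * S t chi x| <= M.
Proof.
move=> t0 M0 Cphi Cpsi Cchi le x Kx.
have Cl : in_C bc Om (fun y => a * phi y + b * psi y).
  by apply: in_CD; exact: in_CZ.
have := semigroup_lin2 1 c t0 Cl Cchi Kx.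
rewrite mul1r (semigroup_lin2 a b t0 Cphi Cpsi Kx) => <-.
apply: semigroup_bound => //.
  by apply: in_CD; apply: in_CZ.
by move=> y Ky; rewrite mul1r; exact: le.
Qed.

Lemma semigroup_contractB t phi psi M : 0 <= t -> 0 <= M ->
  in_C bc Om phi -> in_C bc Om psi ->
  (forall x, closure Om x -> `|phi x - psi x| <= M) ->
  forall x, closure Om x -> `|S t phi x - S t psi x| <= M.
Proof.
move=> t0 M0 Cphi Cpsi le x Kx.
have := @semigroup_comb3 t 1 (-1) 0 phi psi psi M t0 M0 Cphi Cpsi Cpsi.
move=> /(_ _ x Kx); rewrite !mul0r !addr0 !mul1r !mulN1r; apply=> y Ky.
by rewrite mul0r addr0 mul1r mulN1r; exact: le.
Qed.

Lemma semigroup_right_continuous phi e : in_C bc Om phi -> 0 < e ->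
  exists2 del, 0 < del & forall k, 0 <= k < del ->
    forall x, closure Om x -> `|S k phi x - phi x| <= e.
Proof.
move=> Cphi e0.
have /cvgrPdist_le /(_ _ e0) := semigroup_continuous csg Cphi.
move=> [del /= del0 h]; exists del => // k /andP[k0 kdel] x Kx.
move: k0; rewrite le_eqVlt => /predU1P[<-|k0].
  by rewrite (semigroup0 csg Cphi) ?inE// subrr normr0 ltW.
have CS := semigroup_in_C csg (ltW k0) Cphi.
have := h k; rewrite /= sub0r normrN gtr0_norm// => /(_ kdel k0).
rewrite sub0r normrN => /(le_trans (ler_norm _)); apply: le_trans.
exact: (supnorm_ubound bO (in_CB CS Cphi) Kx).
Qed.

(** For [s <= s'], [S s' - S s = S s (S (s' - s) - 1)] and [S s] is a
    contraction: continuity at 0 from the right is uniform continuity. *)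
Lemma semigroup_uniformly_continuous phi e : in_C bc Om phi -> 0 < e ->
  exists2 del, 0 < del & forall s s', 0 <= s -> 0 <= s' -> `|s - s'| < del ->
    forall x, closure Om x -> `|S s phi x - S s' phi x| <= e.
Proof.
move=> Cphi e0; have [del del0 H] := semigroup_right_continuous Cphi e0.
exists del => //.
have incr s s' : 0 <= s -> s <= s' -> s' - s < del ->
    forall x, closure Om x -> `|S s' phi x - S s phi x| <= e.
  move=> s0 ss' dss' x Kx; have k0 : 0 <= s' - s by rewrite subr_ge0.
  rewrite -{1}(subrKC s s') (semigroupD csg s0 k0 Cphi) ?inE//.
  have CS := semigroup_in_C csg k0 Cphi.
  by apply: semigroup_contractB => //; [exact: ltW | apply: H; rewrite k0].
move=> s s' s0 s'0 ss' x Kx; have [le|/ltW le] := leP s' s.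
  by apply: incr => //; rewrite (le_lt_trans (ler_norm _)).
by rewrite distrC; apply: incr => //; rewrite (le_lt_trans (ler_norm _))// distrC.
Qed.

End semigroup.

(** * Variation of constants *)

Lemma is_derive_expR_affine {R : realType} (a b s : R) :
  is_derive s 1 (fun s => expR (a * s + b)) (a * expR (a * s + b)).
Proof.
have H : is_derive s 1 (fun s : R => a * s + b) a.
  by apply: is_derive_eq; rewrite /GRing.scale/=; ring.
by rewrite mulrC; exact: is_derive1_comp.
Qed.

Section duhamel.
Context {R : realType} {d : nat}.
Local Notation E := 'rV[R]_d.
Variables (bc : @boundary_condition R d) (Om : set E).
Variable S : R -> (E -> R) -> (E -> R).
Variables (eps kappa : R).
Hypotheses (bO : bounded_set Om) (csg : contraction_semigroup bc Om S).
Hypotheses (eps0 : 0 < eps) (kappa0 : 0 <= kappa).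
Implicit Types (phi psi : E -> R) (x : E).

Local Notation expL := (expL eps kappa S).

Let epsM_ge0 t : 0 <= t -> 0 <= eps ^+ 2 * t.
Proof. by move=> t0; rewrite mulr_ge0// sqr_ge0. Qed.

Lemma expL_in_C t phi : 0 <= t -> in_C bc Om phi -> in_C bc Om (expL t phi).
Proof.
by move=> t0 Cphi; exact: in_CZ (semigroup_in_C csg (epsM_ge0 t0) Cphi).
Qed.

Lemma expL_bound t phi M : 0 <= t -> 0 <= M -> in_C bc Om phi ->
  (forall x, closure Om x -> `|phi x| <= M) ->
  forall x, closure Om x -> `|expL t phi x| <= expR (- (kappa * t)) * M.
Proof.
move=> t0 M0 Cphi phiM x Kx; rewrite normrM (gtr0_norm (expR_gt0 _)).
rewrite ler_pM2l ?expR_gt0//.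
exact: (semigroup_bound bO csg (epsM_ge0 t0) M0 Cphi phiM Kx).
Qed.

Lemma expL_contractB t phi psi M : 0 <= t -> 0 <= M ->
  in_C bc Om phi -> in_C bc Om psi ->
  (forall x, closure Om x -> `|phi x - psi x| <= M) ->
  forall x, closure Om x ->
    `|expL t phi x - expL t psi x| <= expR (- (kappa * t)) * M.
Proof.
move=> t0 M0 Cphi Cpsi le x Kx.
rewrite -mulrBr normrM (gtr0_norm (expR_gt0 _)) ler_pM2l ?expR_gt0//.
exact: (semigroup_contractB bO csg (epsM_ge0 t0) M0 Cphi Cpsi le Kx).
Qed.

Lemma expL0 phi x : in_C bc Om phi -> closure Om x -> expL 0 phi x = phi x.
Proof.
move=> Cphi Kx; rewrite /Defs.expL !mulr0 oppr0 expR0 mul1r.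
by rewrite (semigroup0 csg Cphi)// inE.
Qed.

Lemma expR_decay_le1 t : 0 <= t -> expR (- (kappa * t)) <= 1.
Proof. by move=> t0; rewrite -expR0 ler_expR oppr_le0 mulr_ge0. Qed.

Lemma expL_continuous_path h Q :
  (forall s, 0 <= s <= h -> in_C bc Om (Q s)) -> continuous_path Om h Q ->
  continuous_path Om h (fun s => expL (h - s) (Q s)).
Proof.
move=> CQ cQ s sh e e0; have CQs := CQ _ sh.
have [M QM] := in_C_bounded bO CQs.
pose M1 := Num.max M 1; have M10 : 0 < M1 by rewrite lt_max ltr01 orbT.
have e3 : 0 < e / 3 by rewrite divr_gt0.
have [d1 d10 H1] := cQ _ sh _ e3.
have [d2 d20 H2] := semigroup_uniformly_continuous bO csg CQs e3.
have ce : {for s, continuous (fun s' => expR (- (kappa * (h - s'))))}.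
  apply: continuous_comp; last exact: continuous_expR.
  apply: cvgN; apply: cvgM; first exact: cvg_cst.
  by apply: cvgB; [exact: cvg_cst | exact: cvg_id].
have eM : 0 < e / 3 / M1 by rewrite divr_gt0.
have /cvgrPdist_le /(_ _ eM) [d3 /= d30 H3] := ce.
have q0 : 0 < d2 / eps ^+ 2 by rewrite divr_gt0// exprn_gt0.
exists (Num.min d1 (Num.min (d2 / eps ^+ 2) d3)).
  by rewrite !lt_min d10 q0 d30.
move=> s' s'h; rewrite !lt_min => /and3P[sd1 sd2 sd3] x Kx.
have hs : 0 <= h - s by rewrite subr_ge0; case/andP: sh.
have hs' : 0 <= h - s' by rewrite subr_ge0; case/andP: s'h.
have t1 : `|expL (h - s') (Q s') x - expL (h - s') (Q s) x| <= e / 3.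
  have := expL_contractB hs' (ltW e3) (CQ _ s'h) CQs (H1 _ s'h sd1) Kx.
  move/le_trans; apply; rewrite ler_piMl ?(ltW e3)//; exact: expR_decay_le1.
have t2 : `|S (eps ^+ 2 * (h - s')) (Q s) x - S (eps ^+ 2 * (h - s)) (Q s) x| <= e / 3.
  apply: H2 => //; [exact: epsM_ge0..|].
  rewrite -mulrBr normrM gtr0_norm ?exprn_gt0// mulrC -ltr_pdivlMr ?exprn_gt0//.
  by rewrite (_ : h - s' - (h - s) = - (s' - s)) ?normrN//; ring.
have t3 : `|expR (- (kappa * (h - s))) - expR (- (kappa * (h - s')))| <= e / 3 / M1.
  by apply: H3; rewrite /= distrC.
have QsM : `|S (eps ^+ 2 * (h - s)) (Q s) x| <= M1.
  apply: (semigroup_bound bO csg (epsM_ge0 hs) (ltW M10) CQs _ Kx).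
  by move=> y /QM /le_trans; apply; rewrite le_max lexx.
move: t1; rewrite /Defs.expL.
have := expR_decay_le1 hs'; have := expR_gt0 (- (kappa * (h - s'))).
set a := expR _; set b := expR _ in t3 *; move=> a0 a1.
set p := S _ (Q s') x; set q := S _ (Q s) x in t2 *; set r := S _ (Q s) x in t2 QsM *.
move=> t1.
rewrite (_ : a * p - b * r = (a * p - a * q) + a * (q - r) - (b - a) * r); last ring.
apply: le_trans (ler_normB _ _) _; rewrite (_ : e = e / 3 + e / 3 + e / 3); last by field.
apply: lerD; last first.
  rewrite normrM (_ : e / 3 = e / 3 / M1 * M1); first exact: ler_pM.
  by rewrite divfK// gt_eqF.
apply: le_trans (ler_normD _ _) _; apply: lerD => //.
by rewrite normrM (gtr0_norm a0) -[e / 3]mul1r; apply: ler_pM => //; exact: ltW.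
Qed.

Lemma is_derive_quotient (f : R -> R) (s l : R) :
  (forall e, 0 < e -> exists2 del, 0 < del & forall k, k != 0 -> `|k| < del ->
    `|k^-1 * (f (s + k) - f s) - l| <= e) -> is_derive s 1 f l.
Proof.
move=> H.
have cf : k^-1 *: ((f \o shift s) (k *: 1) - f s) @[k --> 0^'] --> (l : R).
  apply/cvgrPdist_le => e /H[del del0 {}H]; exists del => //= k.
  rewrite /= sub0r normrN => kd k0; rewrite distrC.
  have -> : k *: (1 : R) + s = s + k by rewrite [_ *: _]mulr1 addrC.
  exact: H.
by apply: DeriveDef; [apply/cvg_ex; exists l | exact: cvg_lim].
Qed.

Lemma time_difference_quotient T (u : R -> E -> R) t v e :
  (forall s, 0 <= s <= T -> in_C bc Om (u s)) -> 0 <= t <= T ->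
  in_C bc Om v -> is_time_derivative Om T u t v -> 0 < e ->
  exists2 del, 0 < del & forall k, k != 0 -> `|k| < del -> 0 <= t + k <= T ->
    forall x, closure Om x -> `|k^-1 * (u (t + k) x - u t x) - v x| <= e.
Proof.
move=> Cu tT Cv /cvgrPdist_le H e0.
have [del /= del0 {}H] := H _ e0; exists del => // k k0 kd tk x Kx.
have := H k; rewrite /= sub0r normrN => /(_ kd k0 tk).
rewrite sub0r normrN => /(le_trans (ler_norm _)); apply: le_trans.
exact: (supnorm_ubound bO
  (in_CB (in_CZ k^-1 (in_CB (Cu _ tk) (Cu _ tT))) Cv) Kx).
Qed.

Hypothesis gen : generated_by_laplacian bc Om S.

Lemma laplacian_generator phi psi e : is_laplacian bc Om phi psi -> 0 < e ->
  exists2 del, 0 < del & forall k, 0 < k < del -> forall x, closure Om x ->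
    `|k^-1 * (S (eps ^+ 2 * k) phi x - phi x) - eps ^+ 2 * psi x| <= e.
Proof.
move=> lap e0; have [Cphi Cpsi _] := lap.
have q0 : 0 < eps ^+ 2 by rewrite exprn_gt0.
have e'0 : 0 < e / eps ^+ 2 by rewrite divr_gt0.
have /cvgrPdist_le /(_ _ e'0) [del /= del0 H] := iffLR (gen Cphi Cpsi) lap.
exists (del / eps ^+ 2); first by rewrite divr_gt0.
move=> k /andP[k0 kdel] x Kx; have p0 : 0 < eps ^+ 2 * k by rewrite mulr_gt0.
have pdel : eps ^+ 2 * k < del by rewrite mulrC -ltr_pdivlMr.
have := H (eps ^+ 2 * k); rewrite /= sub0r normrN gtr0_norm// => /(_ pdel p0).
rewrite sub0r normrN => /(le_trans (ler_norm _)) le.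
have CS := semigroup_in_C csg (ltW p0) Cphi.
have /le_trans /(_ le) := supnorm_ubound bO
  (in_CB (in_CZ (eps ^+ 2 * k)^-1 (in_CB CS Cphi)) Cpsi) Kx.
rewrite ler_pdivlMr// mulrC -[X in X * _](gtr0_norm q0) -normrM.
congr (`|_| <= _); field.
by rewrite !gt_eqF.
Qed.

(** The increment of [S (eps ^+ 2 * (h - s)) (u (t + s))] over [k] splits into
    one of [u] and one of the semigroup.  Factoring out the semigroup at the
    later of the times [s] and [s + k], whatever the sign of [k], leaves only
    right increments of the semigroup, which is all that the generator
    controls. *)
Lemma is_derive_semigroup_path T (u : R -> E -> R) v psi r t h s x :
  0 < s < h -> 0 <= t -> t + h <= T ->
  (forall s, 0 <= s <= T -> in_C bc Om (u s)) ->
  is_time_derivative Om T u (t + s) v ->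
  is_laplacian bc Om (u (t + s)) psi -> in_C bc Om r ->
  (forall x, closure Om x -> v x = eps ^+ 2 * psi x + r x) -> closure Om x ->
  is_derive s 1 (fun s' => S (eps ^+ 2 * (h - s')) (u (t + s')) x)
                (S (eps ^+ 2 * (h - s)) r x).
Proof.
move=> /andP[s0 sh] t0 thT Cu du lap Cr vE Kx.
have [Cw Cpsi _] := lap.
pose v' := fun y => eps ^+ 2 * psi y + r y.
have Cv' : in_C bc Om v' by apply: in_CD => //; exact: in_CZ.
have {}du : is_time_derivative Om T u (t + s) v'.
  move: du; rewrite /is_time_derivative; apply: cvg_trans.
  apply: near_eq_cvg; apply: nearW => k.
  congr sup; apply/seteqP; split=> _ [y Ky <-]; exists y => //; by rewrite vE.
have tsT : 0 <= t + s <= T by apply/andP; split; lra.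
apply: is_derive_quotient => e e0; pose e' := e / 3.
have e'0 : 0 < e' by rewrite divr_gt0.
have [d1 d10 H1] := time_difference_quotient Cu tsT Cv' du e'0.
have [d2 d20 H2] := laplacian_generator lap e'0.
have [d3 d30 H3] := semigroup_uniformly_continuous bO csg Cr e'0.
have [d4 d40 H4] := semigroup_right_continuous bO csg Cv' e'0.
have q0 : 0 < eps ^+ 2 by rewrite exprn_gt0.
exists (Num.min d1 (Num.min d2 (Num.min (d3 / eps ^+ 2) (Num.min (d4 / eps ^+ 2)
  (Num.min s (h - s)))))).
  by rewrite !lt_min d10 d20 !divr_gt0// s0 subr_gt0.
move=> k k0; rewrite !lt_min.
move=> /andP[kd1 /andP[kd2 /andP[kd3 /andP[kd4 /andP[ks khs]]]]].
move: kd3 kd4; rewrite !ltr_pdivlMr// => kd3 kd4.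
have tskT : 0 <= t + s + k <= T.
  by move: ks khs; rewrite !ltr_norml => /andP[? ?] /andP[? ?]; apply/andP; split; lra.
have {}H1 y : closure Om y -> `|k^-1 * (u (t + s + k) y - u (t + s) y) - v' y| <= e'.
  exact: H1.
have Cw1 := Cu _ tskT; rewrite addrA.
have e'E : e = e' + e' + e' by rewrite /e'; field.
have [k_lt0|k_gt0|k_eq0] := ltgtP k 0; last by rewrite k_eq0 eqxx in k0.
- pose p := eps ^+ 2 * (h - s); pose q := eps ^+ 2 * (- k).
  have p0 : 0 <= p by rewrite mulr_ge0// ?(ltW q0)// subr_ge0 ltW.
  have q_ge0 : 0 <= q by rewrite mulr_ge0// ?(ltW q0)// oppr_ge0 ltW.
  have CSw1 := semigroup_in_C csg q_ge0 Cw1.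
  have CSw := semigroup_in_C csg q_ge0 Cw.
  rewrite (_ : eps ^+ 2 * (h - (s + k)) = p + q); last by rewrite /p/q; ring.
  rewrite (semigroupD csg p0 q_ge0 Cw1) ?inE// -/p.
  rewrite [X in `|X|](_ : _ = k^-1 * S p (S q (u (t + s + k))) x +
    - k^-1 * S p (u (t + s)) x + -1 * S p r x); last by ring.
  apply: (semigroup_comb3 bO csg p0 (ltW e0) CSw1 Cw Cr _ Kx) => y Ky.
  have b1 : `|k^-1 * S q (u (t + s + k)) y + - k^-1 * S q (u (t + s)) y +
      -1 * S q v' y| <= e'.
    apply: (semigroup_comb3 bO csg q_ge0 (ltW e'0) Cw1 Cw Cv' _ Ky) => z Kz.
    have := H1 _ Kz; rewrite (_ : _ - v' z = k^-1 * u (t + s + k) z +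
      - k^-1 * u (t + s) z + -1 * v' z)//; ring.
  have b2 : `|S q v' y - v' y| <= e'.
    by apply: H4 => //; rewrite q_ge0 /q mulrC -(ltr0_norm k_lt0).
  have b3 : `|(- k)^-1 * (S q (u (t + s)) y - u (t + s) y) - eps ^+ 2 * psi y| <= e'.
    by apply: H2 => //; rewrite oppr_gt0 k_lt0 -(ltr0_norm k_lt0).
  move: b1 b2 b3; rewrite invrN.
  set a := k^-1; set w1 := S q (u (t + s + k)) y; set w2 := S q (u (t + s)) y.
  set w := u (t + s) y.
  rewrite (_ : a * w1 + - a * w + -1 * r y = (a * w1 + - a * w2 + -1 * S q v' y) +
    (S q v' y - v' y) - (- a * (w2 - w) - eps ^+ 2 * psi y)); last first.
    by rewrite /v'; ring.
  move=> b1 b2 b3; rewrite e'E; apply: le_trans (ler_normB _ _) _.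
  by apply: lerD => //; apply: le_trans (ler_normD _ _) _; exact: lerD.
- pose p := eps ^+ 2 * (h - (s + k)); pose q := eps ^+ 2 * k.
  have skh : s + k < h by move: khs; rewrite ltr_norml => /andP[_]; lra.
  have p0 : 0 <= p by rewrite mulr_ge0// ?(ltW q0)// subr_ge0 ltW.
  have q_ge0 : 0 <= q by rewrite mulr_ge0// ?(ltW q0)// ltW.
  have CSw := semigroup_in_C csg q_ge0 Cw.
  rewrite (_ : eps ^+ 2 * (h - s) = p + q); last by rewrite /p/q; ring.
  rewrite (semigroupD csg p0 q_ge0 Cw) ?inE// -/p.
  have b1 : `|S p r x - S (p + q) r x| <= e'.
    apply: H3 => //; first exact: addr_ge0.
    by rewrite opprD addrA subrr sub0r normrN ger0_norm// /q mulrC -(gtr0_norm k_gt0).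
  rewrite [X in `|X|](_ : _ = (k^-1 * S p (u (t + s + k)) x +
    - k^-1 * S p (S q (u (t + s))) x + -1 * S p r x) +
    (S p r x - S (p + q) r x)); last by ring.
  rewrite e'E; apply: le_trans (ler_normD _ _) _; apply: lerD => //.
  have e'2 : 0 <= e' + e' by rewrite addr_ge0// ltW.
  apply: (semigroup_comb3 bO csg p0 e'2 Cw1 CSw Cr _ Kx) => y Ky.
  have b2 : `|k^-1 * (S q (u (t + s)) y - u (t + s) y) - eps ^+ 2 * psi y| <= e'.
    by apply: H2 => //; rewrite k_gt0 -(gtr0_norm k_gt0).
  rewrite [X in `|X|](_ : _ = (k^-1 * (u (t + s + k) y - u (t + s) y) - v' y) -
    (k^-1 * (S q (u (t + s)) y - u (t + s) y) - eps ^+ 2 * psi y)); last first.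
    by rewrite /v'; ring.
  by apply: le_trans (ler_normB _ _) _; apply: lerD => //; exact: H1.
Qed.

Lemma is_derive_expL_path T (u : R -> E -> R) v psi r t h s x :
  0 < s < h -> 0 <= t -> t + h <= T ->
  (forall s, 0 <= s <= T -> in_C bc Om (u s)) ->
  is_time_derivative Om T u (t + s) v ->
  is_laplacian bc Om (u (t + s)) psi -> in_C bc Om r ->
  (forall x, closure Om x -> v x = eps ^+ 2 * psi x + r x) -> closure Om x ->
  is_derive s 1 (fun s' => expL (h - s') (u (t + s')) x)
                (expL (h - s) (fun y => kappa * u (t + s) y + r y) x).
Proof.
move=> sh t0 thT Cu du lap Cr vE Kx; have [Cw _ _] := lap.
have hs : 0 <= h - s by rewrite subr_ge0; case/andP: sh => _ /ltW.
have dS := is_derive_semigroup_path sh t0 thT Cu du lap Cr vE Kx.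
have dE : is_derive s 1 (fun s' => expR (- (kappa * (h - s'))))
    (kappa * expR (- (kappa * (h - s)))).
  have := is_derive_expR_affine kappa (- (kappa * h)) s.
  rewrite (_ : kappa * s + _ = - (kappa * (h - s))); last by ring.
  by congr is_derive; apply/funext => s'; congr expR; ring.
have xK : x \in closure Om by rewrite inE.
rewrite /Defs.expL (semigroup_linear csg kappa (epsM_ge0 hs) Cw Cr xK).
apply: is_derive_eq; rewrite /GRing.scale/=; ring.
Qed.

End duhamel.

(** * The nonlocal reaction term *)

Section reaction.
Context {R : realType}.
Implicit Types a b l kappa : R.

Lemma gAC_itv01 a : `|a| <= 1 -> 0 <= gAC a <= 1.
Proof.
by rewrite ler_norml /gAC => /andP[? ?]; apply/andP; split; nra.
Qed.

(** Both gaps factor: [kappa - N = (1 - a) (kappa - (1 + a) (a - l))], and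
    [kappa + N = (1 + a) (kappa + (1 - a) (a - l))]. *)
Lemma reaction_bound kappa a l : 4 <= kappa -> `|a| <= 1 -> `|l| <= 1 ->
  `|kappa * a + fAC a - l * gAC a| <= kappa.
Proof.
move=> k4; rewrite !ler_norml /fAC /gAC => /andP[a1 a2] /andP[l1 l2].
apply/andP; split; rewrite -subr_ge0.
  rewrite (_ : _ - - kappa = (1 + a) * (kappa + (1 - a) * (a - l))); last by ring.
  by apply: mulr_ge0; [lra | nra].
rewrite (_ : _ - _ = (1 - a) * (kappa - (1 + a) * (a - l))); last by ring.
by apply: mulr_ge0; [lra | nra].
Qed.

(** The slope is [1 - (a ^+ 2 + a b + b ^+ 2) + l (a + b)].  Its lower bound is
    what [4 <= kappa] compensates: [kappa + q] is nonnegative and at most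
    [kappa + 4 / 3]. *)
Lemma reaction_slope a b l : `|a| <= 1 -> `|b| <= 1 -> `|l| <= 1 ->
  exists2 q, fAC a - fAC b - l * (gAC a - gAC b) = q * (a - b) &
    - 4 <= q <= 4 / 3.
Proof.
rewrite !ler_norml => /andP[a1 a2] /andP[b1 b2] /andP[l1 l2].
exists (1 - (a ^+ 2 + a * b + b ^+ 2) + l * (a + b)).
  by rewrite /fAC /gAC; ring.
have ab : a ^+ 2 + a * b + b ^+ 2 = 3 / 4 * (a + b) ^+ 2 + 1 / 4 * (a - b) ^+ 2.
  by field.
rewrite ab; set p := a + b; set m := a - b.
have p2 : - 2 <= p <= 2 by rewrite /p; apply/andP; split; lra.
have lp : `|l * p| <= `|p| by rewrite normrM ler_piMl// ler_norml l1.
have m0 : 0 <= m ^+ 2 by exact: sqr_ge0.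
move: lp; rewrite ler_norml => /andP[lp1 lp2]; move/andP: p2 => [p1 p2].
apply/andP; split; last first.
  (* [1 + |p| - 3 / 4 * p ^+ 2] is largest, with value 4 / 3, at [|p| = 2 / 3]. *)
  have : 0 <= (`|p| - 2 / 3) ^+ 2 by exact: sqr_ge0.
  by rewrite sqrrB real_normK ?num_real//; lra.
have : a ^+ 2 <= 1 by nra.
have : b ^+ 2 <= 1 by nra.
have : a * b <= 1 by nra.
have : `|p| <= 2 by rewrite ler_norml p1.
move: ab; rewrite -/p -/m; lra.
Qed.

End reaction.

Section nonlocal.
Context {R : realType} {d : nat}.
Local Notation E := 'rV[R]_d.
Variables (bc : @boundary_condition R d) (Om : set E).
Hypotheses (oO : open Om) (bO : bounded_set Om).
Implicit Types xi eta : E -> R.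

Lemma integral_fAC_le xi : in_C bc Om xi ->
  (forall x, closure Om x -> `|xi x| <= 1) ->
  `|integral_over Om (fAC \o xi)| <= integral_over Om (gAC \o xi).
Proof.
move=> Cxi xi1; apply: (ler_norm_integral_over oO bO (in_C_fAC Cxi) (in_C_gAC Cxi)).
move=> x Kx /=; have /andP[g0 _] := gAC_itv01 (xi1 _ Kx).
rewrite (_ : fAC _ = xi x * gAC (xi x)); last by rewrite /fAC /gAC; ring.
by rewrite normrM (ger0_norm g0) ler_piMl// xi1.
Qed.

(** When the denominator vanishes, so does the numerator, which makes the
    convention [lambda = 0] harmless here. *)
Lemma lambdaK xi : in_C bc Om xi ->
  (forall x, closure Om x -> `|xi x| <= 1) ->
  lambda Om xi * integral_over Om (gAC \o xi) = integral_over Om (fAC \o xi).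
Proof.
move=> Cxi xi1; have fg := integral_fAC_le Cxi xi1.
have [g0|g0] := eqVneq (integral_over Om (gAC \o xi)) 0.
  by move: fg; rewrite g0 mulr0 normr_le0 => /eqP ->.
by rewrite /lambda divfK.
Qed.

Lemma lambda_le1 xi : in_C bc Om xi ->
  (forall x, closure Om x -> `|xi x| <= 1) -> `|lambda Om xi| <= 1.
Proof.
move=> Cxi xi1; have fg := integral_fAC_le Cxi xi1.
have g0 : 0 <= integral_over Om (gAC \o xi) by exact: le_trans fg.
rewrite /lambda normrM normfV (ger0_norm g0).
have [->|gn0] := eqVneq (integral_over Om (gAC \o xi)) 0.
  by rewrite invr0 mulr0.
by rewrite ler_pdivrMr ?mul1r// lt0r gn0.
Qed.

Lemma Nop_bound kappa xi : 4 <= kappa -> in_C bc Om xi ->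
  (forall x, closure Om x -> `|xi x| <= 1) ->
  forall x, closure Om x -> `|Nop Om kappa xi x| <= kappa.
Proof.
move=> k4 Cxi xi1 x Kx; apply: reaction_bound => //; first exact: xi1.
exact: lambda_le1.
Qed.

(** With [l = lambda eta], the difference [lambda xi - l] is the integral of
    [f(xi) - f(eta) - l (g(xi) - g(eta))] divided by that of [g(xi)]; the
    integrand is at most [4 |xi - eta|] because [|l| <= 1]. *)
Lemma lambda_lipschitz xi eta g0 del : in_C bc Om xi -> in_C bc Om eta ->
  (forall x, closure Om x -> `|xi x| <= 1) ->
  (forall x, closure Om x -> `|eta x| <= 1) ->
  0 < g0 -> g0 <= integral_over Om (gAC \o xi) ->
  (forall x, closure Om x -> `|xi x - eta x| <= del) ->
  `|lambda Om xi - lambda Om eta| <= 4 * del * volume Om / g0.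
Proof.
move=> Cxi Ceta xi1 eta1 g0_gt0 g0le xieta.
set G := integral_over Om (gAC \o xi) in g0le *.
have G0 : 0 < G by exact: lt_le_trans g0le.
set l := lambda Om eta.
have l1 : `|l| <= 1 by exact: lambda_le1.
have [Cf Cg] := (in_C_fAC Cxi, in_C_gAC Cxi).
have [Cf' Cg'] := (in_C_fAC Ceta, in_C_gAC Ceta).
pose D := integral_over Om (fun x => ((fAC \o xi) x - (fAC \o eta) x) -
  l * ((gAC \o xi) x - (gAC \o eta) x)).
have -> : lambda Om xi - l = D / G.
  rewrite /D (integral_overB oO bO (in_CB Cf Cf') (in_CZ l (in_CB Cg Cg'))).
  rewrite (integral_overZ oO bO _ (in_CB Cg Cg')).
  rewrite (integral_overB oO bO Cf Cf') (integral_overB oO bO Cg Cg').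
  rewrite -[integral_over Om (fAC \o eta)]lambdaK// -/l -/G /lambda -/G.
  by field; rewrite gt_eqF.
have DM : `|D| <= 4 * del * volume Om.
  apply: (integral_over_bound oO bO (in_CB (in_CB Cf Cf') (in_CZ l (in_CB Cg Cg')))).
  move=> x Kx /=.
  have [q -> /andP[q1 q2]] := reaction_slope (xi1 _ Kx) (eta1 _ Kx) l1.
  rewrite normrM; apply: ler_pM => //; last exact: xieta.
  by rewrite ler_norml q1/=; lra.
rewrite normrM normfV (gtr0_norm G0); apply: ler_pM => //.
  by rewrite invr_ge0 ltW.
by rewrite lef_pV2.
Qed.

Lemma Nop_lipschitz kappa xi eta g0 del : 4 <= kappa ->
  in_C bc Om xi -> in_C bc Om eta ->
  (forall x, closure Om x -> `|xi x| <= 1) ->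
  (forall x, closure Om x -> `|eta x| <= 1) ->
  0 < g0 -> g0 <= integral_over Om (gAC \o xi) ->
  (forall x, closure Om x -> `|xi x - eta x| <= del) ->
  forall x, closure Om x -> `|Nop Om kappa xi x - Nop Om kappa eta x| <=
    (kappa + 4 / 3 + 4 * volume Om / g0) * del.
Proof.
move=> k4 Cxi Ceta xi1 eta1 g0_gt0 g0le xieta x Kx.
have lipl := lambda_lipschitz Cxi Ceta xi1 eta1 g0_gt0 g0le xieta.
have l1 := lambda_le1 Ceta eta1.
have [q qE /andP[q1 q2]] := reaction_slope (xi1 _ Kx) (eta1 _ Kx) l1.
rewrite (_ : _ - _ = (kappa + q) * (xi x - eta x) -
  (lambda Om xi - lambda Om eta) * gAC (xi x)); last first.
  by rewrite mulrDl -qE /Nop; ring.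
rewrite [X in _ <= X]mulrDl; apply: le_trans (ler_normB _ _) _; apply: lerD.
  rewrite normrM; apply: ler_pM => //; last exact: xieta.
  by rewrite ler_norml; apply/andP; split; lra.
have /andP[gx0 gx1] := gAC_itv01 (xi1 _ Kx).
rewrite normrM (ger0_norm gx0) -[X in _ <= X]mulr1; apply: ler_pM => //.
by apply: le_trans lipl _; rewrite le_eqVlt; apply/orP; left; apply/eqP; ring.
Qed.

End nonlocal.

(** * Regularity in time *)

(** The part of [C^(1,1)] regularity on [[0, T]] that the error analysis uses:
    besides boundedness and Lipschitz continuity, linear interpolation over a
    step [h] is accurate to [h ^+ 2].  Unlike differentiability, these bounds
    pass through products, quotients and integrals by algebra alone. *)
Definition C11_bound {R : realType} (T M : R) (a : R -> R) : Prop :=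
  [/\ 0 <= M,
      forall t, 0 <= t <= T -> `|a t| <= M,
      forall s t, 0 <= s <= T -> 0 <= t <= T -> `|a s - a t| <= M * `|s - t| &
      forall t h s, 0 <= t -> 0 < h -> t + h <= T -> 0 <= s <= h ->
        `|a (t + s) - ((1 - s / h) * a t + s / h * a (t + h))| <= M * h ^+ 2].

Section C11_scalar.
Context {R : realType} (T : R).
Implicit Types (a b : R -> R) (M N : R).

Lemma C11_bound_cst (c : R) : C11_bound T `|c| (fun=> c).
Proof.
split=> // [s t _ _|t h s _ h0 _ _]; first by rewrite subrr normr0 mulr_ge0.
rewrite (_ : c - _ = 0); last by ring.
by rewrite normr0 mulr_ge0// sqr_ge0.
Qed.

Lemma C11_boundD M N a b : C11_bound T M a -> C11_bound T N b ->
  C11_bound T (M + N) (fun t => a t + b t).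
Proof.
move=> [M0 aM aL aI] [N0 bN bL bI]; split; first exact: addr_ge0.
- by move=> t tT; apply: le_trans (ler_normD _ _) _; apply: lerD; [exact: aM|exact: bN].
- move=> s t sT tT; rewrite opprD addrACA mulrDl.
  by apply: le_trans (ler_normD _ _) _; apply: lerD; [exact: aL|exact: bL].
- move=> t h s t0 h0 thT sh; rewrite [X in _ <= X]mulrDl.
  rewrite (_ : _ - _ = (a (t + s) - ((1 - s / h) * a t + s / h * a (t + h))) +
    (b (t + s) - ((1 - s / h) * b t + s / h * b (t + h)))); last by ring.
  by apply: le_trans (ler_normD _ _) _; apply: lerD; [exact: aI|exact: bI].
Qed.

Let itv_step (t h s : R) : 0 <= t -> 0 < h -> t + h <= T -> 0 <= s <= h ->
  [/\ 0 <= t <= T, 0 <= t + h <= T, 0 <= t + s <= T & 0 <= s / h <= 1].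
Proof.
move=> t0 h0 thT /andP[s0 sh]; split; try by apply/andP; split; lra.
by rewrite divr_ge0//= ?(ltW h0)// ler_pdivrMr// mul1r.
Qed.

Let convex_le (th M x y : R) : 0 <= th <= 1 -> `|x| <= M -> `|y| <= M ->
  `|(1 - th) * x + th * y| <= M.
Proof.
by move=> /andP[? ?]; rewrite !ler_norml => /andP[? ?] /andP[? ?];
  apply/andP; split; nra.
Qed.

(** Interpolation is not multiplicative, but its defect is quadratic:
    [I(a) I(b) - I(ab) = - th (1 - th) (a1 - a0) (b1 - b0)]. *)
Let interp_defect (th h M N a0 a1 b0 b1 : R) : 0 <= th <= 1 -> 0 < h ->
  0 <= M -> 0 <= N -> `|a1 - a0| <= M * h -> `|b1 - b0| <= N * h ->
  `|((1 - th) * a0 + th * a1) * ((1 - th) * b0 + th * b1) -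
    ((1 - th) * (a0 * b0) + th * (a1 * b1))| <= M * N * h ^+ 2.
Proof.
move=> /andP[th0 th1] h0 M0 N0 da db.
rewrite (_ : _ - _ = - (th * (1 - th) * ((a1 - a0) * (b1 - b0)))); last by ring.
rewrite normrN normrM (_ : M * N * _ = 1 * ((M * h) * (N * h))); last by ring.
apply: ler_pM => //; last by rewrite normrM; exact: ler_pM.
by rewrite ger0_norm ?mulr_ge0 ?subr_ge0//; nra.
Qed.

Lemma C11_boundM M N a b : C11_bound T M a -> C11_bound T N b ->
  C11_bound T (3 * (M * N)) (fun t => a t * b t).
Proof.
move=> [M0 aM aL aI] [N0 bN bL bI]; have MN0 := mulr_ge0 M0 N0; split.
- lra.
- move=> t tT; rewrite normrM.
  have : `|a t| * `|b t| <= M * N by apply: ler_pM => //; [exact: aM|exact: bN].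
  lra.
- move=> s t sT tT.
  rewrite (_ : _ - _ = (a s - a t) * b s + a t * (b s - b t)); last by ring.
  apply: le_trans (ler_normD _ _) _; rewrite !normrM.
  have : `|a s - a t| * `|b s| <= M * `|s - t| * N.
    by apply: ler_pM => //; [exact: aL|exact: bN].
  have : `|a t| * `|b s - b t| <= M * (N * `|s - t|).
    by apply: ler_pM => //; [exact: aM|exact: bL].
  have : 0 <= M * N * `|s - t| by rewrite mulr_ge0.
  lra.
- move=> t h s t0 h0 thT sh.
  have [tT thT' tsT th01] := itv_step t0 h0 thT sh.
  set th := s / h in th01 *.
  have := aI _ _ _ t0 h0 thT sh; have := bI _ _ _ t0 h0 thT sh; rewrite -/th.
  have hE : `|t + h - t| = h by rewrite (_ : t + h - t = h) ?gtr0_norm//; ring.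
  have := aL _ _ thT' tT; have := bL _ _ thT' tT; rewrite hE => db da.
  have := convex_le th01 (aM _ tT) (aM _ thT').
  have := interp_defect th01 h0 M0 N0 da db.
  set Ia := (1 - th) * a t + _; set Ib := (1 - th) * b t + _ => defect IaM eb ea.
  rewrite (_ : _ - _ = (a (t + s) - Ia) * b (t + s) + Ia * (b (t + s) - Ib) +
    (Ia * Ib - ((1 - th) * (a t * b t) + th * (a (t + h) * b (t + h)))));
    last by ring.
  rewrite (_ : 3 * (M * N) * h ^+ 2 = M * h ^+ 2 * N + M * (N * h ^+ 2) +
    M * N * h ^+ 2); last by ring.
  apply: le_trans (ler_normD _ _) _; apply: lerD => //.
  apply: le_trans (ler_normD _ _) _; rewrite !normrM; apply: lerD.
    by apply: ler_pM => //; exact: bN.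
  by apply: ler_pM.
Qed.

(** With [c = 1 / b], the interpolant of [b c] is 1, so that
    [b (c - I(c)) = I(bc) - I(b) I(c) - (b - I(b)) I(c)] is again controlled by
    the product defect and the error of [b]. *)
Lemma C11_boundV M g b : 0 < g -> (forall t, 0 <= t <= T -> g <= b t) ->
  C11_bound T M b ->
  C11_bound T (g^-1 + 2 * (M * g^-1 ^+ 2) + M ^+ 2 * g^-1 ^+ 3) (fun t => (b t)^-1).
Proof.
move=> g0 gb [M0 bM bL bI].
have b0 t : 0 <= t <= T -> 0 < b t by move=> /gb; exact: lt_le_trans.
have gV0 : 0 <= g^-1 by rewrite invr_ge0 ltW.
have bV t : 0 <= t <= T -> `|(b t)^-1| <= g^-1.
  move=> tT; rewrite normfV (gtr0_norm (b0 _ tT)) lef_pV2 ?posrE//; [|exact: b0].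
  exact: gb.
have N0 : 0 <= M * g^-1 ^+ 2 by rewrite mulr_ge0// exprn_ge0.
have Q0 : 0 <= M ^+ 2 * g^-1 ^+ 3 by rewrite mulr_ge0// exprn_ge0.
have bVL s t : 0 <= s <= T -> 0 <= t <= T ->
    `|(b s)^-1 - (b t)^-1| <= M * g^-1 ^+ 2 * `|s - t|.
  move=> sT tT; have [bs bt] := (b0 _ sT, b0 _ tT).
  rewrite (_ : _ - _ = (b t - b s) * ((b s)^-1 * (b t)^-1)); last first.
    by field; rewrite !gt_eqF.
  rewrite normrM (_ : M * _ * _ = M * `|s - t| * (g^-1 * g^-1)); last by ring.
  apply: ler_pM => //; first by rewrite distrC; exact: bL.
  by rewrite normrM; apply: ler_pM => //; exact: bV.
split=> [|t tT|s t sT tT|].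
- lra.
- by have := bV _ tT; lra.
- apply: le_trans (bVL _ _ sT tT) _; apply: ler_wpM2r => //; lra.
move=> t h s t0 h0 thT sh.
have [tT thT' tsT th01] := itv_step t0 h0 thT sh.
set th := s / h in th01 *.
have := bI _ _ _ t0 h0 thT sh; rewrite -/th => eb.
have hE : `|t + h - t| = h by rewrite (_ : t + h - t = h) ?gtr0_norm//; ring.
have := bL _ _ thT' tT; have := bVL _ _ thT' tT; rewrite hE => dc db.
have IcM := convex_le th01 (bV _ tT) (bV _ thT').
have := interp_defect th01 h0 M0 N0 db dc.
rewrite !mulfV ?gt_eqF ?b0//.
set Ib := (1 - th) * b t + _ in eb *; set Ic := (1 - th) * (b t)^-1 + _ in IcM *.
rewrite (_ : Ib * Ic - _ = Ib * Ic - 1); last by ring.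
move=> defect; have bts := b0 _ tsT.
rewrite (_ : _ - Ic = (b (t + s))^-1 *
  (- (Ib * Ic - 1) - (b (t + s) - Ib) * Ic)); last by field; rewrite gt_eqF.
rewrite normrM; apply: (@le_trans _ _ (g^-1 * (M * (M * g^-1 ^+ 2) * h ^+ 2 +
    M * h ^+ 2 * g^-1))).
  apply: ler_pM => //; first exact: bV.
  apply: le_trans (ler_normB _ _) _; rewrite normrN normrM; apply: lerD => //.
  exact: ler_pM.
rewrite (_ : g^-1 * _ = (M ^+ 2 * g^-1 ^+ 3 + M * g^-1 ^+ 2) * h ^+ 2); last by ring.
by apply: ler_wpM2r; [exact: sqr_ge0 | lra].
Qed.

End C11_scalar.

Section C11_paths.
Context {R : realType} {d : nat}.
Local Notation E := 'rV[R]_d.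
Variables (bc : @boundary_condition R d) (Om : set E).
Hypotheses (oO : open Om) (bO : bounded_set Om).
Variable T : R.
Implicit Types a b u : R -> E -> R.

Definition C11_path a : Prop :=
  exists M, forall x, closure Om x -> C11_bound T M (a ^~ x).

Lemma C11_path_cst c : C11_path (fun _ _ => c).
Proof. by exists `|c| => x _; exact: C11_bound_cst. Qed.

Lemma C11_pathD a b : C11_path a -> C11_path b ->
  C11_path (fun t x => a t x + b t x).
Proof.
move=> [M aM] [N bN]; exists (M + N) => x Kx.
by apply: C11_boundD; [exact: aM | exact: bN].
Qed.

Lemma C11_pathM a b : C11_path a -> C11_path b ->
  C11_path (fun t x => a t x * b t x).
Proof.
move=> [M aM] [N bN]; exists (3 * (M * N)) => x Kx.
by apply: C11_boundM; [exact: aM | exact: bN].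
Qed.

Lemma C11_pathZ c a : C11_path a -> C11_path (fun t x => c * a t x).
Proof. by apply: C11_pathM; exact: C11_path_cst. Qed.

Lemma C11_pathB a b : C11_path a -> C11_path b ->
  C11_path (fun t x => a t x - b t x).
Proof.
move=> Ca Cb; rewrite (_ : (fun _ => _) = fun t x => a t x + -1 * b t x).
  by apply: C11_pathD => //; exact: C11_pathZ.
by apply/funext => t; apply/funext => x; rewrite mulN1r.
Qed.

Lemma C11_pathV g b : 0 < g -> C11_path b ->
  (forall t x, 0 <= t <= T -> closure Om x -> g <= b t x) ->
  C11_path (fun t x => (b t x)^-1).
Proof.
move=> g0 [M bM] gb; eexists => x Kx.
by apply: (@C11_boundV _ _ M g) => [//|t tT|]; [exact: gb | exact: bM].
Qed.

Lemma C11_path_integral a : (forall t, 0 <= t <= T -> in_C bc Om (a t)) ->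
  C11_path a -> C11_path (fun t _ => integral_over Om (a t)).
Proof.
move=> Ca [M aM]; exists (M * volume Om) => x0 Kx0.
have [M0 _ _ _] := aM _ Kx0.
split.
- by rewrite mulr_ge0// volume_ge0.
- move=> t tT; apply: (integral_over_bound oO bO (Ca _ tT)) => x /aM[_ + _ _].
  exact.
- move=> s t sT tT; rewrite [X in _ <= X]mulrAC -(integral_overB oO bO (Ca _ sT) (Ca _ tT)).
  apply: (integral_over_bound oO bO (in_CB (Ca _ sT) (Ca _ tT))) => x /aM[_ _ + _].
  exact.
- move=> t h s t0 h0 thT sh; rewrite [X in _ <= X]mulrAC.
  have tT : 0 <= t <= T by apply/andP; split; lra.
  have thT' : 0 <= t + h <= T by apply/andP; split; lra.
  have tsT : 0 <= t + s <= T by case/andP: sh => *; apply/andP; split; lra.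
  rewrite -(integral_overZ oO bO (1 - s / h) (Ca _ tT)).
  rewrite -(integral_overZ oO bO (s / h) (Ca _ thT')).
  have C1 := in_CZ (1 - s / h) (Ca _ tT); have C2 := in_CZ (s / h) (Ca _ thT').
  rewrite -(integral_overD oO bO C1 C2).
  rewrite -(integral_overB oO bO (Ca _ tsT) (in_CD C1 C2)).
  apply: (integral_over_bound oO bO (in_CB (Ca _ tsT) (in_CD C1 C2))).
  by move=> x /aM[_ _ _ +]; exact.
Qed.

Lemma C11_path_gAC u : C11_path u -> C11_path (fun t => gAC \o u t).
Proof.
move=> Cu; rewrite (_ : (fun t => gAC \o u t) = fun t x => 1 - u t x * u t x).
  by apply: C11_pathB; [exact: C11_path_cst | exact: C11_pathM].
by apply/funext => t; apply/funext => x; rewrite /= /gAC expr2.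
Qed.

Lemma C11_path_fAC u : C11_path u -> C11_path (fun t => fAC \o u t).
Proof.
move=> Cu; rewrite (_ : (fun t => fAC \o u t) = fun t x => u t x * (gAC \o u t) x).
  by apply: C11_pathM => //; exact: C11_path_gAC.
by apply/funext => t; apply/funext => x; rewrite /= /fAC /gAC; ring.
Qed.

Lemma C11_path_Nop kappa g u : (forall t, 0 <= t <= T -> in_C bc Om (u t)) ->
  0 < g -> (forall t, 0 <= t <= T -> g <= integral_over Om (gAC \o u t)) ->
  C11_path u -> C11_path (fun t => Nop Om kappa (u t)).
Proof.
move=> CCu g0 gu Cu; apply: C11_pathB.
  by apply: C11_pathD; [exact: C11_pathZ | exact: C11_path_fAC].
apply: C11_pathM; last exact: C11_path_gAC.
apply: C11_pathM.
  by apply: C11_path_integral; [move=> t /CCu; exact: in_C_fAC | exact: C11_path_fAC].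
apply: (C11_pathV g0); last by move=> t x tT _; exact: gu.
by apply: C11_path_integral; [move=> t /CCu; exact: in_C_gAC | exact: C11_path_gAC].
Qed.

Lemma C11_path_continuous t h a : 0 <= t -> t + h <= T -> C11_path a ->
  continuous_path Om h (fun s => a (t + s)).
Proof.
move=> t0 thT [M aM] s sh e e0.
exists (e / (`|M| + 1)); first by rewrite divr_gt0// ltr_pwDr.
move=> s' s'h ss' x Kx; have [M0 _ aL _] := aM _ Kx.
have tsT : 0 <= t + s <= T by case/andP: sh => *; apply/andP; split; lra.
have ts'T : 0 <= t + s' <= T by case/andP: s'h => *; apply/andP; split; lra.
apply: le_trans (aL _ _ ts'T tsT) _.
rewrite (_ : t + s' - (t + s) = s' - s); last by ring.
have M10 : 0 < `|M| + 1 by rewrite ltr_pwDr.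
move: ss'; rewrite ltr_pdivlMr// => /ltW; apply: le_trans; rewrite mulrC.
by rewrite ler_wpM2l// (le_trans (ler_norm _))// lerDl.
Qed.

Lemma time_MVT u v x (a b : R) :
  (forall t, 0 <= t <= T -> in_C bc Om (u t)) ->
  (forall t, 0 <= t <= T -> in_C bc Om (v t)) ->
  (forall t, 0 <= t <= T -> is_time_derivative Om T u t (v t)) ->
  closure Om x -> 0 <= a -> a < b -> b <= T ->
  exists2 c, a < c < b & u b x - u a x = v c x * (b - a).
Proof.
move=> Cu Cv du Kx a0 ab bT.
have dux t e : 0 <= t <= T -> 0 < e -> exists2 del, 0 < del &
    forall k, k != 0 -> `|k| < del -> 0 <= t + k <= T ->
    `|k^-1 * (u (t + k) x - u t x) - v t x| <= e.
  move=> tT e0; have [del del0 H] := time_difference_quotient bO Cu tT (Cv _ tT) (du _ tT) e0.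
  by exists del => // k *; exact: H.
have cu : {within `[a, b], continuous (u ^~ x)}.
  apply/subspace_continuousP => s; rewrite /= in_itv/= => /andP[sa sb].
  apply/cvgrPdist_le => e e0.
  have sT : 0 <= s <= T by apply/andP; split; lra.
  have [del del0 H] := dux _ _ sT ltr01.
  have N0 : 0 < `|v s x| + 1 by rewrite ltr_pwDr.
  have del'0 : 0 < Num.min del (e / (`|v s x| + 1)) by rewrite lt_min del0 divr_gt0.
  rewrite near_withinE; apply: filterS (nbhsx_ballx s _ del'0) => s'.
  rewrite /ball/= lt_min => /andP[d1 d2]; rewrite in_itv/= => /andP[s'a s'b].
  have [->|ss'] := eqVneq s' s; first by rewrite subrr normr0 ltW.
  have k0 : s' - s != 0 by rewrite subr_eq0.
  have := H (s' - s) k0; rewrite distrC (subrKC s) => /(_ d1).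
  have s'T : 0 <= s' <= T by apply/andP; split; lra.
  move=> /(_ s'T) H1; rewrite distrC.
  have q : `|(s' - s)^-1 * (u s' x - u s x)| <= `|v s x| + 1.
    rewrite -[X in `|X|](subrK (v s x)) addrC.
    by apply: le_trans (ler_normD _ _) _; exact: lerD.
  rewrite -[u s' x - u s x](mulKf k0) mulrCA mulrC normrM.
  move: d2; rewrite distrC ltr_pdivlMr// => /ltW; apply: le_trans.
  by rewrite mulrC; apply: ler_wpM2l.
have dux1 c : c \in `]a, b[ -> is_derive c 1 (u ^~ x) (v c x).
  rewrite in_itv/= => /andP[ac cb]; apply: is_derive_quotient => e e0.
  have cT : 0 <= c <= T by apply/andP; split; lra.
  have [del del0 H] := dux _ _ cT e0.
  exists (Num.min del (Num.min c (T - c))); first by rewrite !lt_min del0; lra.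
  move=> k k0; rewrite !lt_min => /and3P[kd kc kT]; apply: H => //.
  by move: kc kT; rewrite !ltr_norml => /andP[? ?] /andP[? ?]; apply/andP; split; lra.
by have [c] := MVT ab dux1 cu; rewrite in_itv/=; exists c.
Qed.

(** A bound of [u t] serves all times near [t]; compactness of [[0, T]] makes one
    bound serve them all. *)
Lemma path_bounded u : (forall t, 0 <= t <= T -> in_C bc Om (u t)) ->
  (forall t, 0 <= t <= T ->
    supnorm Om (fun x => u s x - u t x) @[s --> within `[0, T] (nbhs t)] --> (0 : R)) ->
  exists M, forall t, 0 <= t <= T -> forall x, closure Om x -> `|u t x| <= M.
Proof.
move=> Cu cu.
have : \forall M \near +oo, `[0, T]%classic `<=`
    [set t | 0 <= t <= T -> forall x, closure Om x -> `|u t x| <= M].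
  have cover := iffLR (compact_near_coveringP _) (@segment_compact R 0 T).
  apply: (cover R +oo (fun M t => 0 <= t <= T ->
    forall x, closure Om x -> `|u t x| <= M)) => t.
  rewrite /= in_itv/= => tT.
  have [M0 uM0] := in_C_bounded bO (Cu _ tT).
  have /cvgrPdist_le /(_ _ ltr01) := cu _ tT; rewrite near_withinE => nt.
  exists ([set s | s \in `[0, T] -> `|0 - supnorm Om (fun x => u s x - u t x)| <= 1],
          [set M | M0 + 1 <= M]).
    by split => //=; apply: nbhs_pinfty_ge; exact: num_real.
  move=> [s M] /= [su sM] sT x Kx.
  have := su; rewrite in_itv/= => /(_ sT).
  rewrite sub0r normrN => /(le_trans (ler_norm _)) le.
  have /le_trans /(_ le) := supnorm_ubound bO (in_CB (Cu _ sT) (Cu _ tT)) Kx.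
  have := uM0 _ Kx; rewrite !ler_norml => /andP[? ?] /andP[? ?].
  by apply/andP; split; lra.
move=> /filter_ex[M sub]; exists M => t tT x Kx.
by apply: sub => //; rewrite /= in_itv.
Qed.

(** The mean value theorem gives the interpolation bound: with
    [s = th * h], the error is [th (1 - th) h] times a difference of two values
    of [u'], which is Lipschitz. *)
Lemma C2_in_time_C11_path u : 0 <= T -> C2_in_time bc Om T u -> C11_path u.
Proof.
move=> T0 [u1 [u2 H]].
have Cu t (tT : 0 <= t <= T) : in_C bc Om (u t) by have [[]] := H _ tT.
have Cu1 t (tT : 0 <= t <= T) : in_C bc Om (u1 t) by have [[]] := H _ tT.
have Cu2 t (tT : 0 <= t <= T) : in_C bc Om (u2 t) by have [[]] := H _ tT.
have du t (tT : 0 <= t <= T) : is_time_derivative Om T u t (u1 t).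
  by have [_ []] := H _ tT.
have du1 t (tT : 0 <= t <= T) : is_time_derivative Om T u1 t (u2 t).
  by have [_ []] := H _ tT.
have [M2 u2M] : exists M, forall t, 0 <= t <= T ->
    forall x, closure Om x -> `|u2 t x| <= M.
  by apply: path_bounded => // t tT; have [_ []] := H _ tT.
have T00 : 0 <= (0 : R) <= T by rewrite lexx.
have lip v w M : (forall t, 0 <= t <= T -> in_C bc Om (v t)) ->
    (forall t, 0 <= t <= T -> in_C bc Om (w t)) ->
    (forall t, 0 <= t <= T -> is_time_derivative Om T v t (w t)) ->
    (forall t, 0 <= t <= T -> forall x, closure Om x -> `|w t x| <= M) ->
    forall x s t, closure Om x -> 0 <= s <= T -> 0 <= t <= T ->
    `|v s x - v t x| <= M * `|s - t|.
  move=> Cv Cw dv wM x.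
  have incr s t : closure Om x -> 0 <= s -> s < t -> t <= T ->
      `|v t x - v s x| <= M * `|t - s|.
    move=> Kx s0 st tT; have [c /andP[sc ct] ->] := time_MVT Cv Cw dv Kx s0 st tT.
    by rewrite normrM ler_wpM2r//; apply: wM => //; apply/andP; split; lra.
  move=> s t Kx /andP[s0 sT] /andP[t0 tT].
  have [st|ts|->] := ltgtP s t; last by rewrite !subrr normr0 mulr0.
    by rewrite distrC (distrC s); exact: incr.
  exact: incr.
have lip1 := lip u1 u2 M2 Cu1 Cu2 du1 u2M.
have [N1 u1N] := in_C_bounded bO (Cu1 _ T00).
have [N0 u0N] := in_C_bounded bO (Cu _ T00).
pose M1 := N1 + `|M2| * T.
have u1M t : 0 <= t <= T -> forall x, closure Om x -> `|u1 t x| <= M1.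
  move=> tT x Kx; rewrite -(subrKC (u1 0 x) (u1 t x)).
  apply: le_trans (ler_normD _ _) _; apply: lerD; first exact: u1N.
  apply: le_trans (lip1 _ _ _ Kx tT T00) _; rewrite subr0.
  case/andP: tT => t0 tT; rewrite ger0_norm//; apply: le_trans (ler_wpM2r t0 (ler_norm M2)) _.
  exact: ler_wpM2l.
have lip0 := lip u u1 M1 Cu Cu1 du u1M.
pose M0 := N0 + `|M1| * T.
have uM t : 0 <= t <= T -> forall x, closure Om x -> `|u t x| <= M0.
  move=> tT x Kx; rewrite -(subrKC (u 0 x) (u t x)).
  apply: le_trans (ler_normD _ _) _; apply: lerD; first exact: u0N.
  apply: le_trans (lip0 _ _ _ Kx tT T00) _; rewrite subr0.
  case/andP: tT => t0 tT; rewrite ger0_norm//; apply: le_trans (ler_wpM2r t0 (ler_norm M1)) _.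
  exact: ler_wpM2l.
pose M := `|M0| + `|M1| + `|M2|.
have [M0M M1M M2M] : [/\ M0 <= M, M1 <= M & M2 <= M].
  have := (ler_norm M0, ler_norm M1, ler_norm M2).
  move=> [[? ?] ?]; have := (normr_ge0 M0, normr_ge0 M1, normr_ge0 M2).
  by move=> [[? ?] ?]; rewrite /M; split; lra.
exists M => x Kx; split.
- by rewrite !addr_ge0.
- by move=> t tT; apply: le_trans (uM _ tT _ Kx) _.
- move=> s t sT tT; apply: le_trans (lip0 _ _ _ Kx sT tT) _.
  exact: ler_wpM2r.
move=> t h s t0 h0 thT /andP[s0 sh].
have Mh0 : 0 <= M * h ^+ 2 by rewrite mulr_ge0 ?sqr_ge0// !addr_ge0.
have [s_eq0|sn0] := eqVneq s 0.
  rewrite s_eq0 mul0r addr0 (_ : _ - _ = 0) ?normr0//; ring.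
have [s_eqh|snh] := eqVneq s h.
  rewrite s_eqh divff ?gt_eqF// (_ : _ - _ = 0) ?normr0//; ring.
have {}s0 : 0 < s by rewrite lt_neqAle eq_sym sn0.
have {}sh : s < h by rewrite lt_neqAle snh.
have ts_lt : t < t + s by rewrite ltrDl.
have tsT : t + s <= T by lra.
have [c1 /andP[c11 c12] e1] := time_MVT Cu Cu1 du Kx t0 ts_lt tsT.
have ts0 : 0 <= t + s by lra.
have tsh : t + s < t + h by lra.
have [c2 /andP[c21 c22] e2] := time_MVT Cu Cu1 du Kx ts0 tsh thT.
have c1T : 0 <= c1 <= T by apply/andP; split; lra.
have c2T : 0 <= c2 <= T by apply/andP; split; lra.
set th := s / h.
have sE : s = th * h by rewrite /th divfK// gt_eqF.
rewrite (_ : _ - _ = (1 - th) * (u (t + s) x - u t x) -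
  th * (u (t + h) x - u (t + s) x)); last by ring.
rewrite e1 e2 (_ : _ - _ = th * (1 - th) * h * (u1 c1 x - u1 c2 x)); last first.
  by rewrite {1 2}sE; ring.
have th01 : 0 <= th <= 1.
  by apply/andP; split; [exact: divr_ge0 (ltW _) (ltW _) | rewrite ler_pdivrMr// mul1r ltW].
have dc : `|u1 c1 x - u1 c2 x| <= M * h.
  apply: le_trans (lip1 _ _ _ Kx c1T c2T) _.
  apply: le_trans (ler_wpM2r (normr_ge0 _) M2M) _; apply: ler_wpM2l.
    by rewrite !addr_ge0.
  by rewrite ler_norml; apply/andP; split; lra.
rewrite normrM expr2 [in X in _ <= X]mulrCA; apply: ler_pM => //.
case/andP: th01 => th0 th1.
have th1' : 0 <= 1 - th by rewrite subr_ge0.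
rewrite (ger0_norm (mulr_ge0 (mulr_ge0 th0 th1') (ltW h0))).
apply: ler_piMl; first exact: ltW.
by apply: mulr_ile1; rewrite ?subr_ge0// gerBl.
Qed.

End C11_paths.

(** * Exponential integrators *)

Section exponential_step.
Context {R : realType} {d : nat}.
Local Notation E := 'rV[R]_d.
Variables (bc : @boundary_condition R d) (Om : set E).
Variable S : R -> (E -> R) -> (E -> R).
Variables (eps kappa : R).
Hypotheses (bO : bounded_set Om) (csg : contraction_semigroup bc Om S).
Hypotheses (eps0 : 0 < eps) (kappa0 : 0 < kappa).
Implicit Types (phi psi : E -> R) (Q : R -> E -> R) (x : E).

Local Notation expL := (expL eps kappa S).

(** Value at time [h] of the mild solution of [w' = L w + Q(s)], [w(0) = phi]:
    both stages of the scheme have this form. *)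
Definition exponential_step h phi Q x : R :=
  expL h phi x + \int[@lebesgue_measure R]_(s in `[0, h]) expL (h - s) (Q s) x.

Let step_in_C Q h : 0 < h -> (forall s, 0 <= s <= h -> in_C bc Om (Q s)) ->
  forall s, 0 <= s <= h -> in_C bc Om (expL (h - s) (Q s)).
Proof.
move=> h0 CQ s sh; apply: (expL_in_C eps kappa csg); last exact: CQ.
by rewrite subr_ge0; case/andP: sh.
Qed.

Lemma exponential_step_in_C h phi Q : 0 < h -> in_C bc Om phi ->
  (forall s, 0 <= s <= h -> in_C bc Om (Q s)) -> continuous_path Om h Q ->
  in_C bc Om (exponential_step h phi Q).
Proof.
move=> h0 Cphi CQ cQ; apply: in_CD; first exact: (expL_in_C eps kappa csg (ltW h0)).
apply: (in_C_path_integral h0) => //; first exact: step_in_C.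
exact: (expL_continuous_path bO csg eps0 (ltW kappa0)).
Qed.

Lemma continuous_expR_affine (c a b : R) :
  continuous (fun s : R => c * expR (a * s + b)).
Proof.
move=> s; apply: cvgM; first exact: cvg_cst.
apply: continuous_comp; last exact: continuous_expR.
by apply: cvgD; [apply: cvgM; [exact: cvg_cst | exact: cvg_id] | exact: cvg_cst].
Qed.

(** Maximum principle of the scheme: a convex combination of [phi] and of the
    values of [Q / kappa] has norm at most 1. *)
Lemma exponential_step_bound h phi Q : 0 < h -> in_C bc Om phi ->
  (forall s, 0 <= s <= h -> in_C bc Om (Q s)) -> continuous_path Om h Q ->
  (forall x, closure Om x -> `|phi x| <= 1) ->
  (forall s, 0 <= s <= h -> forall x, closure Om x -> `|Q s x| <= kappa) ->
  forall x, closure Om x -> `|exponential_step h phi Q x| <= 1.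
Proof.
move=> h0 Cphi CQ cQ phi1 Qk x Kx.
have cp := expL_continuous_path bO csg eps0 (ltW kappa0) CQ cQ.
pose B s := expR (kappa * s + - (kappa * h)).
have := @ler_norm_FTC R h (fun=> 0) (fun=> 0) (fun s => expL (h - s) (Q s) x)
  B (fun s => kappa * B s) h0.
rewrite subrr sub0r normrN /B subrr expR0 mulr0 add0r => H.
have := expL_bound eps kappa bO csg (ltW h0) ler01 Cphi phi1 Kx.
rewrite mulr1 => ephi; apply: le_trans (ler_normD _ _) _.
rewrite -(subrKC (expR (- (kappa * h))) 1); apply: lerD => //.
apply: H.
- by apply: continuous_subspaceT; exact: cst_continuous.
- by apply: continuous_subspaceT; exact: cst_continuous.
- exact: (continuous_path_within cp Kx).
- by move=> s; exact: is_derive_expR_affine.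
- exact: continuous_expR_affine.
move=> s sh; rewrite sub0r normrN mulrC.
have hs : 0 <= h - s by rewrite subr_ge0; case/andP: sh.
rewrite (_ : kappa * s + _ = - (kappa * (h - s))); last by ring.
exact: (expL_bound eps kappa bO csg hs (ltW kappa0) (CQ _ sh) (Qk _ sh) Kx).
Qed.

End exponential_step.

Section scheme.
Context {R : realType} {d : nat}.
Local Notation E := 'rV[R]_d.
Variables (bc : @boundary_condition R d) (Om : set E).
Variable S : R -> (E -> R) -> (E -> R).
Variables (eps kappa tau : R).
Hypotheses (oO : open Om) (bO : bounded_set Om).
Hypotheses (csg : contraction_semigroup bc Om S).
Hypotheses (eps0 : 0 < eps) (k4 : 4 <= kappa) (tau0 : 0 < tau).
Implicit Types (phi psi : E -> R) (x : E).

Let kappa0 : 0 < kappa.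
Proof. exact: lt_le_trans k4. Qed.

Lemma continuous_path_cst phi : continuous_path Om tau (fun=> phi).
Proof. by move=> s _ e e0; exists 1 => // s' _ _ x _; rewrite subrr normr0 ltW. Qed.

Definition interpolate phi psi (s : R) x : R :=
  (1 - s / tau) * phi x + s / tau * psi x.

Lemma interpolate_in_C phi psi s : in_C bc Om phi -> in_C bc Om psi ->
  in_C bc Om (interpolate phi psi s).
Proof. by move=> Cphi Cpsi; exact: in_CD (in_CZ _ Cphi) (in_CZ _ Cpsi). Qed.

Lemma interpolate_continuous phi psi : in_C bc Om phi -> in_C bc Om psi ->
  continuous_path Om tau (interpolate phi psi).
Proof.
move=> Cphi Cpsi s _ e e0.
have [M phiM] := in_C_bounded bO (in_CB Cpsi Cphi).
have M0 : 0 < `|M| + 1 by rewrite ltr_pwDr.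
exists (e / (`|M| + 1) * tau); first by rewrite mulr_gt0// divr_gt0.
move=> s' _ ss' x Kx; rewrite /interpolate.
rewrite (_ : _ - _ = (s' - s) / tau * (psi x - phi x)); last by ring.
rewrite normrM normrM normfV (gtr0_norm tau0).
apply: (@le_trans _ _ (e / (`|M| + 1) * (`|M| + 1))); last first.
  by rewrite divfK// gt_eqF.
apply: ler_pM => //; first by rewrite divr_ge0// ltW.
  by rewrite ler_pdivrMr// ltW.
by apply: le_trans (phiM _ Kx) _; rewrite (le_trans (ler_norm _))// lerDl.
Qed.

Lemma interpolate_bound phi psi s (M : R) x : 0 <= s <= tau ->
  `|phi x| <= M -> `|psi x| <= M -> `|interpolate phi psi s x| <= M.
Proof.
move=> /andP[s0 st]; have : 0 <= s / tau by rewrite divr_ge0// ltW.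
have : s / tau <= 1 by rewrite ler_pdivrMr// mul1r.
rewrite /interpolate; set th := s / tau => th1 th0.
rewrite !ler_norml => /andP[? ?] /andP[? ?]; apply/andP; split; nra.
Qed.

Lemma etd1_in_C phi : in_C bc Om phi -> in_C bc Om (etd1 Om eps kappa S tau phi).
Proof.
move=> Cphi; apply: (exponential_step_in_C bO csg eps0 kappa0 tau0 Cphi).
  by move=> s _; exact: in_C_Nop.
exact: continuous_path_cst.
Qed.

Lemma etd1_le1 phi : in_C bc Om phi ->
  (forall x, closure Om x -> `|phi x| <= 1) ->
  forall x, closure Om x -> `|etd1 Om eps kappa S tau phi x| <= 1.
Proof.
move=> Cphi phi1 x Kx.
apply: (exponential_step_bound bO csg eps0 kappa0 tau0 Cphi _ _ phi1 _ Kx).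
- by move=> s _; exact: in_C_Nop.
- exact: continuous_path_cst.
- by move=> s _; exact: (Nop_bound oO bO k4 Cphi phi1).
Qed.

Let Nop2_in_C phi s : in_C bc Om phi -> in_C bc Om
  (interpolate (Nop Om kappa phi) (Nop Om kappa (etd1 Om eps kappa S tau phi)) s).
Proof.
move=> Cphi; apply: interpolate_in_C; apply: in_C_Nop => //; exact: etd1_in_C.
Qed.

Lemma etdrk2_in_C phi : in_C bc Om phi ->
  in_C bc Om (etdrk2 Om eps kappa S tau phi).
Proof.
move=> Cphi; apply: (exponential_step_in_C bO csg eps0 kappa0 tau0 Cphi).
  by move=> s _; exact: Nop2_in_C.
by apply: interpolate_continuous; apply: in_C_Nop => //; exact: etd1_in_C.
Qed.

Lemma etdrk2_le1 phi : in_C bc Om phi ->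
  (forall x, closure Om x -> `|phi x| <= 1) ->
  forall x, closure Om x -> `|etdrk2 Om eps kappa S tau phi x| <= 1.
Proof.
move=> Cphi phi1 x Kx; have Cphi' := etd1_in_C Cphi.
apply: (exponential_step_bound bO csg eps0 kappa0 tau0 Cphi
  (Q := interpolate (Nop Om kappa phi) (Nop Om kappa (etd1 Om eps kappa S tau phi)))
  _ _ phi1 _ Kx).
- by move=> s _; exact: Nop2_in_C.
- by apply: interpolate_continuous; apply: in_C_Nop.
- move=> s st y Ky; apply: interpolate_bound => //.
    exact: (Nop_bound oO bO k4 Cphi phi1).
  exact: (Nop_bound oO bO k4 Cphi' (etd1_le1 Cphi phi1)).
Qed.

End scheme.

(** * Maximum principle for the exact solution *)

Section excess.
Context {R : realType} {d : nat}.
Local Notation E := 'rV[R]_d.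

(** [|f(a)| <= g(a)] on the unit interval, and beyond it
    [|f(a)| - g(a) = (|a| - 1) (|a| + 1) ^+ 2]. *)
Lemma fAC_excess (a w M : R) : 0 <= w <= M -> `|a| <= 1 + w ->
  `|fAC a| <= gAC a + w * (2 + M) ^+ 2.
Proof.
move=> /andP[w0 wM] aw.
have -> : fAC a = a * gAC a by rewrite /fAC /gAC; ring.
have -> : gAC a = 1 - `|a| ^+ 2 by rewrite /gAC real_normK ?num_real.
have M2 : 0 <= w * (2 + M) ^+ 2 by rewrite mulr_ge0 ?sqr_ge0.
move: (normr_ge0 a) => a0; rewrite normrM.
set b := `|a| in a0 aw *; have [b1|/ltW b1] := leP b 1.
  have g0 : 0 <= 1 - b ^+ 2 by rewrite subr_ge0 expr_le1.
  by rewrite (ger0_norm g0); apply: ler_wpDr => //; rewrite ler_piMl.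
rewrite ler0_norm; last by rewrite subr_le0 expr_ge1.
rewrite (_ : b * _ = 1 - b ^+ 2 + (b - 1) * (b + 1) ^+ 2); last by ring.
rewrite lerD2l; apply: ler_pM; [lra | exact: sqr_ge0 | lra |].
by rewrite ler_sqr ?nnegrE; lra.
Qed.

Lemma reaction_excess (kappa a l w M c : R) : 4 <= kappa -> 0 <= w <= M ->
  0 <= c -> `|a| <= 1 + w -> `|l| <= 1 + w * c ->
  `|kappa * a + fAC a - l * gAC a| <=
    kappa + (kappa + c + (2 + M) * (2 + M + M * c)) * w.
Proof.
move=> k4 /andP[w0 wM] c0 aw lw.
have M0 : 0 <= M by exact: le_trans wM.
have wc0 : 0 <= w * c by rewrite mulr_ge0.
have Mc : w * c <= M * c by rewrite ler_wpM2r.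
have Mc0 : 0 <= M * c by rewrite mulr_ge0.
have P0 : 0 <= (2 + M) * (2 + M + M * c) * w.
  by apply: mulr_ge0 => //; apply: mulr_ge0; lra.
have kw0 : 0 <= kappa * w by apply: mulr_ge0 => //; lra.
have [a1|/ltW a1] := leP `|a| 1.
  have [mu mu1 lmu] : exists2 mu, `|mu| <= 1 & `|l - mu| <= w * c.
    have [l1|l1] := leP `|l| 1; first by exists l; rewrite ?subrr ?normr0.
    (* [sg l] is the point of the unit interval nearest to [l]. *)
    exists (Num.sg l); first by rewrite normr_sg lern1 leq_b1.
    rewrite {1}[l]numEsg -{2}[Num.sg l]mulr1 -mulrBr normrM normr_sg.
    rewrite (_ : l != 0); last by rewrite -normr_gt0 (lt_trans ltr01).
    by rewrite mul1r ger0_norm; lra.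
  have /andP[g0 g1] := gAC_itv01 a1.
  rewrite (_ : _ - _ = (kappa * a + fAC a - mu * gAC a) - (l - mu) * gAC a);
    last by ring.
  have := reaction_bound k4 a1 mu1.
  have : `|(l - mu) * gAC a| <= w * c.
    rewrite normrM (ger0_norm g0) -[X in _ <= X]mulr1; exact: ler_pM.
  move=> h1 h2; apply: le_trans (ler_normB _ _) _; lra.
have h1 : `|kappa * a| <= kappa + kappa * w.
  have k0 : 0 <= kappa by lra.
  by rewrite normrM (ger0_norm k0) -[X in X + _]mulr1 -mulrDr ler_wpM2l.
have h2 : `|gAC a| <= w * (2 + M).
  have -> : gAC a = - ((`|a| - 1) * (`|a| + 1)).
    by rewrite /gAC -(real_normK (num_real a)); ring.
  rewrite normrN normrM; apply: ler_pM => //; rewrite ger0_norm; lra.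
have h3 : `|a - l| <= 2 + M + M * c.
  by apply: le_trans (ler_normB _ _) _; lra.
have h4 : `|gAC a * (a - l)| <= w * (2 + M) * (2 + M + M * c).
  by rewrite normrM; apply: ler_pM.
rewrite (_ : _ - _ = kappa * a + gAC a * (a - l)); last by rewrite /fAC /gAC; ring.
apply: le_trans (ler_normD _ _) _.
have : 0 <= c * w by rewrite mulrC.
lra.
Qed.

Variables (bc : @boundary_condition R d) (Om : set E).
Hypotheses (oO : open Om) (bO : bounded_set Om).

Lemma lambda_excess (xi : E -> R) (g0 w M : R) : in_C bc Om xi ->
  0 < g0 -> g0 <= integral_over Om (gAC \o xi) -> 0 <= w <= M ->
  (forall x, closure Om x -> `|xi x| <= 1 + w) ->
  `|lambda Om xi| <= 1 + w * ((2 + M) ^+ 2 * volume Om / g0).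
Proof.
move=> Cxi g0_gt0 g0le wM xiw; have [Cf Cg] := (in_C_fAC Cxi, in_C_gAC Cxi).
have w0 : 0 <= w by case/andP: wM.
rewrite /lambda; set G := integral_over Om (gAC \o xi) in g0le *.
have G0 : 0 < G by exact: lt_le_trans g0le.
rewrite normrM normfV (gtr0_norm G0) ler_pdivrMr//.
have := ler_norm_integral_over oO bO Cf
  (in_CD Cg (in_C_cst bc Om (w * (2 + M) ^+ 2)))
  (fun x Kx => fAC_excess wM (xiw x Kx)).
rewrite (integral_overD oO bO Cg (in_C_cst _ _ _)) integral_over_cst// -/G.
move=> /le_trans; apply; rewrite mulrDl mul1r lerD2l.
set V := w * (2 + M) ^+ 2 * volume Om.
have V0 : 0 <= V by rewrite mulr_ge0 ?volume_ge0// mulr_ge0// sqr_ge0.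
rewrite (_ : w * _ * G = V * (G / g0)); last by rewrite /V; ring.
by rewrite ler_peMr// ler_pdivlMr// mul1r.
Qed.

Lemma Nop_excess (kappa g0 M : R) : 4 <= kappa -> 0 < g0 -> 0 <= M ->
  exists2 L, 0 < L & forall (xi : E -> R) w, in_C bc Om xi ->
    g0 <= integral_over Om (gAC \o xi) -> 0 <= w ->
    (forall x, closure Om x -> `|xi x| <= 1 + w) ->
    (forall x, closure Om x -> `|xi x| <= 1 + M) ->
    forall x, closure Om x -> `|Nop Om kappa xi x| <= kappa + L * w.
Proof.
move=> k4 g0_gt0 M0; pose c := (2 + M) ^+ 2 * volume Om / g0.
have c0 : 0 <= c by rewrite divr_ge0 ?(ltW g0_gt0)// mulr_ge0 ?sqr_ge0 ?volume_ge0.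
pose L := kappa + c + (2 + M) * (2 + M + M * c).
have L0 : 0 < L.
  rewrite /L; apply: ltr_wpDr; last by apply: ltr_wpDr => //; lra.
  have : 0 <= M * c by exact: mulr_ge0.
  by move=> Mc; apply: mulr_ge0; lra.
exists L => // xi w Cxi g0le w0 xiw xiM x Kx.
(* [L] may depend on [M] but not on [w], which is therefore truncated. *)
pose w' := Num.min w M.
have w'M : 0 <= w' <= M by rewrite le_min w0 M0 ge_min lexx orbT.
have xiw' y : closure Om y -> `|xi y| <= 1 + w'.
  by move=> Ky; rewrite -lerBlDl le_min !lerBlDl xiw// xiM.
have lw := lambda_excess Cxi g0_gt0 g0le w'M xiw'.
apply: le_trans (reaction_excess k4 w'M c0 (xiw' _ Kx) lw) _.
by rewrite lerD2l -/L ler_wpM2l ?(ltW L0)// ge_min lexx.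
Qed.

End excess.

Lemma ler_geometric_error {R : realType} (x y c : R) :
  (forall n, x <= y + c / 2 ^+ n) -> x <= y.
Proof.
move=> H; apply/ler_addgt0Pr => e e0.
have [n cn] : exists n, c / e < n%:R.
  exists (Num.bound `|c / e|); exact: le_lt_trans (ler_norm _) (archi_boundP (normr_ge0 _)).
apply: le_trans (H n) _; rewrite lerD2l ler_pdivrMr ?exprn_gt0// mulrC.
rewrite -ler_pdivrMr//; apply/ltW/(lt_le_trans cn).
by rewrite -natrX ler_nat ltnW// ltn_expl.
Qed.

(** * Convergence *)

Section convergence.
Context {R : realType} {d : nat}.
Local Notation E := 'rV[R]_d.
Variables (bc : @boundary_condition R d) (Om : set E).
Variable S : R -> (E -> R) -> (E -> R).
Variables (eps kappa T g0 Cstar : R) (u0 : E -> R) (u : R -> E -> R).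
Hypotheses (oO : open Om) (bO : bounded_set Om).
Hypotheses (csg : contraction_semigroup bc Om S).
Hypotheses (gen : generated_by_laplacian bc Om S).
Hypotheses (eps0 : 0 < eps) (k4 : 4 <= kappa) (T0 : 0 < T).
Hypotheses (sol : exact_solution bc Om eps T u0 u) (C2u : C2_in_time bc Om T u).
Hypotheses (g0_gt0 : 0 < g0).
Hypothesis gu : forall t, 0 <= t <= T -> g0 <= integral_over Om (gAC \o u t).
Implicit Types (phi psi : E -> R) (Q : R -> E -> R) (x : E).

Local Notation expL := (expL eps kappa S).
Local Notation step := (exponential_step S eps kappa).

Let kappa0 : 0 < kappa.
Proof. exact: lt_le_trans k4. Qed.

Lemma solution_in_C t : 0 <= t <= T -> in_C bc Om (u t).
Proof. by case: C2u => u1 [u2 H] /H[[]]. Qed.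

Lemma solution_C11_path : C11_path Om T u.
Proof. exact: (C2_in_time_C11_path bO (ltW T0) C2u). Qed.

Lemma Nop_solution_C11_path : C11_path Om T (fun t => Nop Om kappa (u t)).
Proof.
apply: (C11_path_Nop oO bO kappa solution_in_C g0_gt0 gu).
exact: solution_C11_path.
Qed.

(** Integrating the derivative of [s |-> expL (h - s) (u (t + s))] over [[0, h]]
    represents [u (t + h)] as an exponential step with initial value [u t] and
    forcing [Nop (u (t + s))]; the semigroup damps both differences. *)
Lemma solution_step_le t h phi Q (e : R) (D B b : R -> R) :
  0 <= t -> 0 < h -> t + h <= T -> in_C bc Om phi ->
  (forall s, 0 <= s <= h -> in_C bc Om (Q s)) -> continuous_path Om h Q ->
  0 <= e -> (forall x, closure Om x -> `|u t x - phi x| <= e) ->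
  (forall s, 0 <= s <= h -> forall x, closure Om x ->
    `|Nop Om kappa (u (t + s)) x - Q s x| <= D s) ->
  (forall s, 0 <= s <= h -> 0 <= D s) ->
  (forall s, 0 <= s <= h -> expR (- (kappa * (h - s))) * D s <= b s) ->
  (forall s : R, is_derive s 1 B (b s)) -> continuous b ->
  forall x, closure Om x ->
    `|u (t + h) x - step h phi Q x| <= expR (- (kappa * h)) * e + (B h - B 0).
Proof.
move=> t0 h0 thT Cphi CQ cQ e_ge0 uphi ND D0 Db dB cb x Kx.
have itv s : 0 <= s <= h -> 0 <= t + s <= T.
  by case/andP=> s0 sh; rewrite addr_ge0//= (le_trans _ thT)// lerD2l.
have t0T : 0 <= t <= T by have := itv 0; rewrite addr0 lexx (ltW h0); exact.
have thT' : 0 <= t + h <= T by apply: itv; rewrite lexx ltW.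
have Cu s (sh : 0 <= s <= h) : in_C bc Om (u (t + s)).
  exact: solution_in_C (itv _ sh).
have CN s (sh : 0 <= s <= h) : in_C bc Om (Nop Om kappa (u (t + s))).
  exact: in_C_Nop (Cu _ sh).
have pu := expL_continuous_path bO csg eps0 (ltW kappa0) Cu
  (C11_path_continuous t0 thT solution_C11_path).
have pN := expL_continuous_path bO csg eps0 (ltW kappa0) CN
  (C11_path_continuous t0 thT Nop_solution_C11_path).
have pQ := expL_continuous_path bO csg eps0 (ltW kappa0) CQ cQ.
have := @ler_norm_FTC R h (fun s => expL (h - s) (u (t + s)) x)
  (fun s => expL (h - s) (Nop Om kappa (u (t + s))) x)
  (fun s => expL (h - s) (Q s) x) B b h0.
rewrite subrr subr0 addr0 (expL0 eps kappa csg (solution_in_C thT') Kx).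
set I := (\int[_]_(_ in _) _)%R => H.
rewrite /exponential_step -/I (_ : _ - _ = (expL h (u t) x - expL h phi x) +
  (u (t + h) x - expL h (u t) x - I)); last by ring.
apply: le_trans (ler_normD _ _) _; apply: lerD.
  exact: (expL_contractB eps kappa bO csg (ltW h0) e_ge0 (solution_in_C t0T) Cphi uphi Kx).
refine (H _ _ _ _ dB cb _).
- move=> s sh; have [s0 sh'] := andP sh.
  have tsT : 0 < t + s <= T.
    by rewrite (ltr_wpDl t0 s0) (le_trans _ thT)// lerD2l ltW.
  have [v [psi [du lap vE]]] := sol.2 _ tsT.
  have shh : 0 <= s <= h by rewrite (ltW s0) (ltW sh').
  pose r y := fAC (u (t + s) y) - lambda Om (u (t + s)) * gAC (u (t + s) y).
  have Cr : in_C bc Om r.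
    exact: in_CB (in_C_fAC (Cu _ shh)) (in_CZ _ (in_C_gAC (Cu _ shh))).
  have vE' y : closure Om y -> v y = eps ^+ 2 * psi y + r y.
    by move=> Ky; rewrite vE ?inE// [RHS]addrA.
  have := is_derive_expL_path kappa bO csg eps0 gen sh t0 thT solution_in_C du lap Cr vE' Kx.
  congr (is_derive _ _ _ (expL _ _ _)).
  by apply/funext => y; rewrite /r /Nop addrA.
- exact: (continuous_path_within pu Kx).
- exact: (continuous_path_within pN Kx).
- exact: (continuous_path_within pQ Kx).
- move=> s sh; apply: le_trans (Db _ sh).
  have hs : 0 <= h - s by rewrite subr_ge0; case/andP: sh.
  exact: (expL_contractB eps kappa bO csg hs (D0 _ sh) (CN _ sh) (CQ _ sh) (ND _ sh) Kx).
Qed.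

Hypothesis u0_le1 : forall x, closure Om x -> `|u0 x| <= 1.

(** The reaction term exceeds [kappa] by at most [L] times the excess of [|u|]
    over 1.  Feeding the bound [1 + w exp(2 L t)] into the variation of
    constants formula returns it with [w] halved; iterating gives [|u| <= 1]. *)
Lemma solution_le1 t : 0 <= t <= T ->
  forall x, closure Om x -> `|u t x| <= 1.
Proof.
move=> tT x Kx; have [M uM] := solution_C11_path.
have [M0 _ _ _] := uM _ Kx.
have uM' s y : 0 <= s <= T -> closure Om y -> `|u s y| <= M.
  by move=> sT Ky; have [_ + _ _] := uM _ Ky; exact.
have [L L0 HL] := Nop_excess bc oO bO k4 g0_gt0 M0.
have u00 y : closure Om y -> u 0 y = u0 y by move=> Ky; rewrite sol.1// inE.
have iter n s y : 0 <= s <= T -> closure Om y ->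
    `|u s y| <= 1 + M / 2 ^+ n * expR (2 * L * s).
  elim: n s y => [|n IH] s y sT Ky.
    rewrite expr0 divr1; apply: le_trans (uM' _ _ sT Ky) _.
    rewrite ler_wpDl// ler_peMr// -expR0 ler_expR.
    by rewrite mulr_ge0 ?mulr_ge0 ?(ltW L0)//; case/andP: sT.
  have w0 : 0 <= M / 2 ^+ n by rewrite divr_ge0 ?exprn_ge0.
  set w := M / 2 ^+ n in IH w0 *.
  have -> : M / 2 ^+ n.+1 = w / 2.
    by rewrite /w exprS invfM mulrCA mulrC.
  have w20 : 0 <= w / 2 by rewrite divr_ge0.
  case/andP: sT => s0 sT; move: s0; rewrite le_eqVlt => /predU1P[<-|s0].
    rewrite u00//; apply: le_trans (u0_le1 Ky) _.
    by rewrite lerDl mulr_ge0 ?expR_ge0.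
  have C0 := in_C_cst bc Om (0 : R).
  pose b (r : R) := kappa * expR (kappa * r + - (kappa * s)) +
    w / 2 * (2 * L * expR (2 * L * r + 0)).
  pose B (r : R) := expR (kappa * r + - (kappa * s)) + w / 2 * expR (2 * L * r + 0).
  pose D (r : R) := kappa + L * (w * expR (2 * L * r)).
  have := @solution_step_le 0 s (fun=> 0) (fun _ _ => 0) 1 D B b (lexx 0) s0.
  rewrite add0r => /(_ sT C0).
  have path0 : continuous_path Om s (fun _ _ => 0 : R).
    by move=> r _ e e0; exists 1 => // r' _ _ z _; rewrite subrr normr0 ltW.
  move=> /(_ (fun _ _ => C0) path0 ler01).
  have rT r : 0 <= r <= s -> 0 <= r <= T.
    by case/andP=> -> /le_trans; apply.
  (* Compared with the zero step, the solution is compared with 0. *)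
  have step0 : step s (fun=> 0) (fun _ _ => 0) y = 0.
    have e0 r : 0 <= r -> expL r (fun=> 0) y = 0.
      have n0 z : closure Om z -> `|0 : R| <= 0 by rewrite normr0.
      move=> r0; have := expL_bound eps kappa bO csg r0 (lexx 0) C0 n0 Ky.
      by rewrite mulr0 normr_le0 => /eqP.
    rewrite /exponential_step (e0 _ (ltW s0)) add0r.
    rewrite (eq_Rintegral _ (g := fun=> 0)) ?Rintegral_cst ?mul0r// => r.
    by rewrite inE/= in_itv/= => /andP[_ rs]; rewrite e0// subr_ge0.
  have H1 z : closure Om z -> `|u 0 z - 0| <= 1.
    by move=> Kz; rewrite subr0 u00// u0_le1.
  have H2 r : 0 <= r <= s -> forall z, closure Om z ->
      `|Nop Om kappa (u (0 + r)) z - 0| <= D r.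
    move=> /rT r_T z Kz; rewrite add0r subr0.
    apply: HL => //; [exact: solution_in_C | exact: gu | by rewrite mulr_ge0 ?expR_ge0 |..].
      by move=> z' Kz'; exact: IH.
    by move=> z' Kz'; rewrite ler_wpDl// uM'.
  have D0 r : 0 <= r <= s -> 0 <= D r.
    by move=> _; rewrite addr_ge0 ?(ltW kappa0)// !mulr_ge0 ?(ltW L0)// expR_ge0.
  have Db r : 0 <= r <= s -> expR (- (kappa * (s - r))) * D r <= b r.
    move=> /andP[r0 rs]; rewrite /D /b mulrDr addr0; apply: lerD.
      by rewrite mulrC (_ : kappa * r + _ = - (kappa * (s - r)))//; ring.
    rewrite (_ : w / 2 * _ = 1 * (L * (w * expR (2 * L * r)))); last by field.
    apply: ler_wpM2r; first by rewrite !mulr_ge0 ?(ltW L0)// expR_ge0.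
    by apply: expR_decay_le1; [exact: ltW | rewrite subr_ge0].
  have dB (r : R) : is_derive r 1 B (b r).
    apply: is_deriveD; first exact: is_derive_expR_affine.
    by apply: is_deriveZ; exact: is_derive_expR_affine.
  have cb : continuous b.
    move=> r; apply: cvgD; first exact: continuous_expR_affine.
    by apply: cvgM; [exact: cvg_cst | exact: continuous_expR_affine].
  move=> /(_ H1 H2 D0 Db dB cb y Ky); rewrite step0 subr0 mulr1 /B.
  rewrite subrr expR0 !mulr0 !addr0 !add0r expR0 mulr1 => /le_trans; apply.
  lra.
apply: (@ler_geometric_error _ _ _ (M * expR (2 * L * t))) => n.
by rewrite mulrAC; exact: iter.
Qed.

Hypothesis u0C : in_C bc Om u0.
Hypothesis Cstar_le : kappa + 4 / 3 + 4 * volume Om / g0 <= Cstar * kappa.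

Let Cstar1 : 1 <= Cstar.
Proof.
have V0 : 0 <= 4 * volume Om / g0.
  by rewrite divr_ge0 ?(ltW g0_gt0)// mulr_ge0// volume_ge0.
rewrite -(ler_pM2r kappa0) mul1r; apply: le_trans Cstar_le.
by rewrite -addrA lerDl addr_ge0.
Qed.

Lemma reaction_error t phi e : 0 <= t <= T -> in_C bc Om phi ->
  (forall x, closure Om x -> `|phi x| <= 1) -> 0 <= e ->
  (forall x, closure Om x -> `|u t x - phi x| <= e) ->
  forall x, closure Om x ->
    `|Nop Om kappa (u t) x - Nop Om kappa phi x| <= Cstar * kappa * e.
Proof.
move=> tT Cphi phi1 e0 uphi x Kx.
apply: le_trans (Nop_lipschitz oO bO k4 (solution_in_C tT) Cphi (solution_le1 tT)
  phi1 g0_gt0 (gu tT) uphi Kx) _.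
exact: ler_wpM2r.
Qed.

(** Freezing the reaction term at [phi] costs [Cstar kappa e] plus a term of
    order [tau] from the motion of [u].  The decay of the semigroup is kept
    against the first, which fixes the growth rate, and dropped against the
    second. *)
Lemma etd1_error : exists2 C, 0 <= C & forall t tau phi e,
  0 <= t -> 0 < tau -> t + tau <= T -> in_C bc Om phi ->
  (forall x, closure Om x -> `|phi x| <= 1) -> 0 <= e ->
  (forall x, closure Om x -> `|u t x - phi x| <= e) ->
  forall x, closure Om x -> `|u (t + tau) x - etd1 Om eps kappa S tau phi x| <=
    (1 + (Cstar - 1) * kappa * tau) * e + C * tau ^+ 2.
Proof.
have [M uM] := solution_C11_path.
pose L := Cstar * kappa.
have L0 : 0 < L by rewrite mulr_gt0// (lt_le_trans ltr01 Cstar1).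
exists (L * `|M|); first by rewrite mulr_ge0// ltW.
move=> t tau phi e t0 tau0 tT Cphi phi1 e0 uphi x Kx.
pose D (s : R) := L * (e + `|M| * tau).
pose B s := Cstar * e * expR (kappa * s + - (kappa * tau)) + L * `|M| * tau * s.
pose b s := Cstar * e * (kappa * expR (kappa * s + - (kappa * tau))) + L * `|M| * tau.
have Mt0 : 0 <= `|M| * tau by rewrite mulr_ge0// ltW.
have itv s : 0 <= s <= tau -> 0 <= t + s <= T.
  by case/andP=> s0 st; rewrite addr_ge0//= (le_trans _ tT)// lerD2l.
have tT0 : 0 <= t <= T by have := itv 0; rewrite addr0 lexx (ltW tau0); exact.
have ND s : 0 <= s <= tau -> forall y, closure Om y ->
    `|Nop Om kappa (u (t + s)) y - Nop Om kappa phi y| <= D s.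
  move=> st; apply: reaction_error => //; [exact: itv | exact: addr_ge0 |].
  move=> y Ky; rewrite (_ : _ - _ = (u t y - phi y) + (u (t + s) y - u t y));
    last by ring.
  apply: le_trans (ler_normD _ _) _; apply: lerD; first exact: uphi.
  have [M0 _ uL _] := uM _ Ky; apply: le_trans (uL _ _ (itv _ st) tT0) _.
  case/andP: st => s0 st; rewrite [t + s]addrC addrK (ger0_norm s0).
  by apply: ler_pM => //; exact: ler_norm.
have D0 s : 0 <= s <= tau -> 0 <= D s.
  by move=> _; apply: mulr_ge0; [exact: ltW | exact: addr_ge0].
have Db s : 0 <= s <= tau -> expR (- (kappa * (tau - s))) * D s <= b s.
  move=> /andP[s0 st]; rewrite /D /b.
  rewrite (_ : kappa * s + _ = - (kappa * (tau - s))); last by ring.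
  have q1 : expR (- (kappa * (tau - s))) <= 1.
    by apply: expR_decay_le1; [exact: ltW | rewrite subr_ge0].
  set q := expR _ in q1 *.
  rewrite (_ : q * _ = Cstar * e * (kappa * q) + q * (L * `|M| * tau)); last first.
    by rewrite /L; ring.
  by rewrite lerD2l ler_piMl// -mulrA mulr_ge0// ltW.
have dB (s : R) : is_derive s 1 B (b s).
  apply: is_deriveD; first by apply: is_deriveZ; exact: is_derive_expR_affine.
  by apply: is_derive_eq; rewrite /GRing.scale/=; ring.
have cb : continuous b.
  move=> s; apply: cvgD; last exact: cvg_cst.
  by apply: cvgM; [exact: cvg_cst | exact: continuous_expR_affine].
have CN (s : R) : 0 <= s <= tau -> in_C bc Om (Nop Om kappa phi).
  by move=> _; exact: in_C_Nop.
have := solution_step_le t0 tau0 tT Cphi CN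
  (@continuous_path_cst _ _ _ tau (Nop Om kappa phi)) e0 uphi ND D0 Db dB cb Kx.
move=> /le_trans; apply; rewrite /B mulr0 add0r subrr expR0 mulr0 addr0 mulr1.
set q := expR _.
rewrite (_ : _ + _ = (1 + (Cstar - 1) * (1 - q)) * e + L * `|M| * tau ^+ 2);
  last by ring.
rewrite lerD2r; apply: ler_wpM2r => //; rewrite lerD2l -mulrA.
apply: ler_wpM2l; first by rewrite subr_ge0.
by have := expR_ge1Dx (- (kappa * tau)); rewrite -/q; lra.
Qed.

(** Up to [O(tau ^+ 2)], the interpolated reaction error is at most
    [Cstar kappa (1 + c s) e] with [c = (Cstar - 1) kappa], hence at most
    [Cstar kappa exp(c s) e].  This is the forcing for which [exp(c s) e] solves
    the scalar equation [y' = - kappa y + Cstar kappa y] exactly, whence the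
    growth factor [exp(c tau)]. *)
Lemma etdrk2_error : exists2 C, 0 <= C & forall t tau phi e,
  0 <= t -> 0 < tau -> t + tau <= T -> in_C bc Om phi ->
  (forall x, closure Om x -> `|phi x| <= 1) -> 0 <= e ->
  (forall x, closure Om x -> `|u t x - phi x| <= e) ->
  forall x, closure Om x -> `|u (t + tau) x - etdrk2 Om eps kappa S tau phi x| <=
    expR ((Cstar - 1) * kappa * tau) * e + C * tau ^+ 3.
Proof.
have [C1 C10 H1] := etd1_error.
have [M NM] := Nop_solution_C11_path.
pose L := Cstar * kappa; pose c := (Cstar - 1) * kappa.
have L0 : 0 < L by rewrite mulr_gt0// (lt_le_trans ltr01 Cstar1).
have c0 : 0 <= c by rewrite mulr_ge0 ?subr_ge0// ltW.
pose C2 := `|M| + L * C1.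
have C20 : 0 <= C2 by rewrite addr_ge0// mulr_ge0// ltW.
exists C2 => // t tau phi e t0 tau0 tT Cphi phi1 e0 uphi x Kx.
pose phi' := etd1 Om eps kappa S tau phi.
have Cphi' : in_C bc Om phi' := etd1_in_C bO csg eps0 k4 tau0 Cphi.
have phi'1 : forall y, closure Om y -> `|phi' y| <= 1.
  exact: (etd1_le1 oO bO csg eps0 k4 tau0 Cphi phi1).
pose e1 := (1 + c * tau) * e + C1 * tau ^+ 2.
have ct0 : 0 <= c * tau by rewrite mulr_ge0// ltW.
have e10 : 0 <= e1.
  by apply: addr_ge0; apply: mulr_ge0 => //; [exact: addr_ge0 | exact: sqr_ge0].
have uphi' y : closure Om y -> `|u (t + tau) y - phi' y| <= e1 by exact: H1.
pose Q := interpolate tau (Nop Om kappa phi) (Nop Om kappa phi').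
have itv s : 0 <= s <= tau -> 0 <= t + s <= T.
  by case/andP=> s0 st; rewrite addr_ge0//= (le_trans _ tT)// lerD2l.
have tT0 : 0 <= t <= T by have := itv 0; rewrite addr0 lexx (ltW tau0); exact.
have tT1 : 0 <= t + tau <= T by apply: itv; rewrite lexx ltW.
pose D s := L * e * expR (c * s) + C2 * tau ^+ 2.
pose B s := e * expR (L * s + - (kappa * tau)) + C2 * tau ^+ 2 * s.
pose b s := e * (L * expR (L * s + - (kappa * tau))) + C2 * tau ^+ 2.
have C2t0 : 0 <= C2 * tau ^+ 2 by rewrite mulr_ge0// sqr_ge0.
have ND s : 0 <= s <= tau -> forall y, closure Om y ->
    `|Nop Om kappa (u (t + s)) y - Q s y| <= D s.
  move=> st y Ky; have [M0 _ _ NI] := NM _ Ky.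
  have {NI} := NI _ _ _ t0 tau0 tT st => NI.
  have E0 := reaction_error tT0 Cphi phi1 e0 uphi Ky.
  have E1 := reaction_error tT1 Cphi' phi'1 e10 uphi' Ky.
  rewrite -/L in E0 E1; case/andP: (st) => s0 st'.
  have th0 : 0 <= s / tau by rewrite divr_ge0// ltW.
  have th1 : s / tau <= 1 by rewrite ler_pdivrMr// mul1r.
  have thE : s / tau * (c * tau) = c * s by field; rewrite gt_eqF.
  move: NI E0 E1 thE; rewrite /Q /interpolate.
  set th := s / tau in th0 th1 *; set Ns := Nop _ _ (u (t + s)) y.
  set N0 := Nop _ _ (u t) y; set N1 := Nop _ _ (u (t + tau)) y.
  move=> NI E0 E1 thE.
  rewrite (_ : _ - _ = (Ns - ((1 - th) * N0 + th * N1)) +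
    ((1 - th) * (N0 - Nop Om kappa phi y) + th * (N1 - Nop Om kappa phi' y)));
    last by ring.
  apply: le_trans (ler_normD _ _) _.
  have h1 : `|(1 - th) * (N0 - Nop Om kappa phi y)| <= (1 - th) * (L * e).
    by rewrite normrM (ger0_norm (_ : 0 <= 1 - th)) ?subr_ge0//;
      apply: ler_wpM2l => //; rewrite subr_ge0.
  have h2 : `|th * (N1 - Nop Om kappa phi' y)| <= th * (L * e1).
    by rewrite normrM (ger0_norm th0); exact: ler_wpM2l.
  apply: le_trans (lerD NI (le_trans (ler_normD _ _) (lerD h1 h2))) _.
  have -> : M * tau ^+ 2 + ((1 - th) * (L * e) + th * (L * e1)) =
      L * e * (1 + th * (c * tau)) + (M + th * (L * C1)) * tau ^+ 2.
    by rewrite /e1; ring.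
  rewrite thE /D; apply: lerD.
    by apply: ler_wpM2l; [rewrite mulr_ge0// ltW | exact: expR_ge1Dx].
  apply: ler_wpM2r; first exact: sqr_ge0.
  apply: lerD; first exact: ler_norm.
  by rewrite ler_piMl// mulr_ge0// ltW.
have D0 s : 0 <= s <= tau -> 0 <= D s.
  by move=> _; apply: addr_ge0 => //; rewrite mulr_ge0 ?expR_ge0// mulr_ge0// ltW.
have Db s : 0 <= s <= tau -> expR (- (kappa * (tau - s))) * D s <= b s.
  move=> /andP[s0 st]; rewrite /D /b.
  rewrite (_ : L * s + _ = - (kappa * (tau - s)) + c * s); last by rewrite /L /c; ring.
  have q1 : expR (- (kappa * (tau - s))) <= 1.
    by apply: expR_decay_le1; [exact: ltW | rewrite subr_ge0].
  rewrite expRD; set q := expR (- _) in q1 *.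
  rewrite (_ : q * _ = e * (L * (q * expR (c * s))) + q * (C2 * tau ^+ 2));
    last by ring.
  by rewrite lerD2l ler_piMl.
have dB (s : R) : is_derive s 1 B (b s).
  apply: is_deriveD; first by apply: is_deriveZ; exact: is_derive_expR_affine.
  by apply: is_derive_eq; rewrite /GRing.scale/=; ring.
have cb : continuous b.
  move=> s; apply: cvgD; last exact: cvg_cst.
  by apply: cvgM; [exact: cvg_cst | exact: continuous_expR_affine].
have CQ (s : R) : 0 <= s <= tau -> in_C bc Om (Q s).
  by move=> _; apply: interpolate_in_C; exact: in_C_Nop.
have cQ : continuous_path Om tau Q.
  exact: (interpolate_continuous bO tau0 (in_C_Nop kappa Cphi) (in_C_Nop kappa Cphi')).
have := solution_step_le t0 tau0 tT Cphi CQ cQ e0 uphi ND D0 Db dB cb Kx.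
move=> /le_trans; apply; rewrite /B !mulr0 add0r addr0.
rewrite (_ : L * tau + _ = c * tau); last by rewrite /L /c; ring.
by rewrite le_eqVlt; apply/orP; left; apply/eqP; ring.
Qed.

Lemma etdrk2_iter_in_C_le1 tau n : 0 < tau ->
  in_C bc Om (etdrk2_iter Om eps kappa S tau u0 n) /\
  forall x, closure Om x -> `|etdrk2_iter Om eps kappa S tau u0 n x| <= 1.
Proof.
move=> tau0; elim: n => [//|n [CU U1]].
split; first exact: (etdrk2_in_C bO csg eps0 k4 tau0 CU).
by move=> x Kx; exact: (etdrk2_le1 oO bO csg eps0 k4 tau0 CU U1 Kx).
Qed.

(** Each of the [n <= T / tau] local errors [C tau ^+ 3] is amplified by at most
    [exp(c n tau)]. *)
Lemma etdrk2_iter_error : exists2 C, 0 <= C & forall tau n, 0 < tau ->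
  n%:R * tau <= T -> forall x, closure Om x ->
    `|u (n%:R * tau) x - etdrk2_iter Om eps kappa S tau u0 n x| <=
    C * expR ((Cstar - 1) * kappa * (n%:R * tau)) * tau ^+ 2.
Proof.
have [C C0 H] := etdrk2_error; pose c := (Cstar - 1) * kappa.
have c0 : 0 <= c by rewrite mulr_ge0 ?subr_ge0// ltW.
exists (T * C); first by rewrite mulr_ge0// ltW.
move=> tau n tau0 nT.
have t3 : 0 <= C * tau ^+ 3 by rewrite mulr_ge0// exprn_ge0// ltW.
have {}H : forall x, closure Om x ->
    `|u (n%:R * tau) x - etdrk2_iter Om eps kappa S tau u0 n x| <=
    n%:R * (C * tau ^+ 3) * expR (c * (n%:R * tau)).
  elim: n nT => [|n IH] nT x Kx.
    by rewrite !mul0r sol.1 ?inE// subrr normr0.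
  have nE : n.+1%:R * tau = n%:R * tau + tau by rewrite -natr1 mulrDl mul1r.
  have t0 : 0 <= n%:R * tau by rewrite mulr_ge0// ltW.
  rewrite nE in nT *; have {}IH := IH (le_trans (ler_wpDr (ltW tau0) (lexx _)) nT).
  have [CU U1] := etdrk2_iter_in_C_le1 n tau0.
  set e := n%:R * (C * tau ^+ 3) * _ in IH.
  have e0 : 0 <= e by apply: mulr_ge0; [exact: mulr_ge0 | exact: expR_ge0].
  apply: le_trans (H _ _ _ _ t0 tau0 nT CU U1 e0 IH _ Kx) _; rewrite -/c.
  rewrite -natr1 (mulrDl _ 1) mul1r mulrDl; apply: lerD.
    by rewrite /e mulrDr expRD le_eqVlt; apply/orP; left; apply/eqP; ring.
  apply: ler_peMr => //; rewrite -[X in X <= _]expR0 ler_expR.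
  by apply: mulr_ge0 => //; apply: addr_ge0 => //; exact: ltW.
move=> x Kx; apply: le_trans (H _ Kx) _.
rewrite -/c (_ : n%:R * (C * tau ^+ 3) * expR (c * (n%:R * tau)) =
  n%:R * tau * (C * expR (c * (n%:R * tau)) * tau ^+ 2)); last by ring.
rewrite (_ : T * C * _ * _ = T * (C * expR (c * (n%:R * tau)) * tau ^+ 2)); last by ring.
apply: ler_wpM2r => //; apply: mulr_ge0; last exact: sqr_ge0.
by apply: mulr_ge0 => //; exact: expR_ge0.
Qed.

End convergence.

Theorem theorem4 (R : realType) (d : nat) (Om : set 'rV[R]_d)
    (bc : @boundary_condition R d) (eps kappa T : R)
    (S : R -> ('rV[R]_d -> R) -> ('rV[R]_d -> R))
    (u0 : 'rV[R]_d -> R) (u : R -> 'rV[R]_d -> R) (gamma_u gamma_d : R) :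
  (d = 2 \/ d = 3)%N ->
  open Om -> connected Om -> bounded_set Om -> lipschitz_boundary Om ->
  compatible bc Om ->
  0 < eps ->
  contraction_semigroup bc Om S -> generated_by_laplacian bc Om S ->
  0 < T ->
  in_C bc Om u0 ->
  stab_const <= kappa ->
  supnorm Om u0 <= 1 ->
  `|integral_over Om u0| != volume Om ->
  exact_solution bc Om eps T u0 u ->
  C2_in_time bc Om T u ->
  0 < gamma_u ->
  (forall t, 0 <= t <= T -> gamma_u <= integral_over Om (gAC \o u t)) ->
  0 < gamma_d ->
  let gamma := Num.min gamma_u gamma_d in
  let C_gamma := 4 * volume Om / gamma + 2 * volume Om ^+ 2 / gamma ^+ 2 in
  let Cstar_gamma := 3 / 2 + C_gamma / 4 in
  exists2 C : R, 0 < C &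
    forall tau : R, 0 < tau ->
      let U := etdrk2_iter Om eps kappa S tau u0 in
      (forall n : nat, n%:R * tau <= T ->
        gamma_d <= integral_over Om (gAC \o U n)) ->
      forall n : nat, n%:R * tau <= T ->
        supnorm Om (fun x => u (n%:R * tau) x - U n x) <=
        C * expR ((Cstar_gamma - 1) * kappa * (n%:R * tau)) * tau ^+ 2.
Proof.
move=> _ oO _ bO _ _ eps0 csg gen T0 u0C; rewrite stab_constE => k4 u0_le1 _.
move=> sol C2u gu0 gu gd0 gamma C_gamma Cstar.
have gamma0 : 0 < gamma by rewrite lt_min gu0.
have u01 x : closure Om x -> `|u0 x| <= 1.
  by move=> Kx; exact: le_trans (supnorm_ubound bO u0C Kx) u0_le1.
have CstarP : kappa + 4 / 3 + 4 * volume Om / gamma_u <= Cstar * kappa.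
  have V0 := volume_ge0 Om.
  pose q := volume Om / gamma.
  have q0 : 0 <= q by rewrite divr_ge0// ltW.
  have qu : volume Om / gamma_u <= q.
    by apply: ler_wpM2l => //; rewrite lef_pV2 ?posrE// ge_min lexx.
  have -> : Cstar = 3 / 2 + q + q ^+ 2 / 2.
    by rewrite /Cstar /C_gamma /q; field; rewrite gt_eqF.
  (* As [4 <= kappa], 4 / 3 is absorbed by [kappa / 2] and [4 q] by [kappa q]. *)
  have q2 : 0 <= q ^+ 2 * kappa by rewrite mulr_ge0 ?sqr_ge0//; lra.
  have qk : 4 * q <= q * kappa by rewrite mulrC ler_wpM2l.
  rewrite -mulrA; lra.
have [C C0 H] := etdrk2_iter_error oO bO csg gen eps0 k4 T0 sol C2u gu0 gu u01 u0C
  CstarP.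
exists (C + 1) => [|tau tau0 U _ n nT]; first by rewrite ltr_wpDl.
have CC x : closure Om x -> `|u (n%:R * tau) x - U n x| <=
    (C + 1) * expR ((Cstar - 1) * kappa * (n%:R * tau)) * tau ^+ 2.
  move=> Kx; apply: le_trans (H _ _ tau0 nT _ Kx) _.
  by rewrite -!mulrA ler_wpM2r ?lerDl// mulr_ge0 ?expR_ge0// sqr_ge0.
apply: supnorm_le => //; apply: mulr_ge0; last exact: sqr_ge0.
by apply: mulr_ge0; [exact: addr_ge0 | exact: expR_ge0].
Qed.
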